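(* Let $n\in\mathbb{N}_0$ and let $\nu$ be a real number. If $\nu>n-1$, then all zeros of $J_\nu^{(n)}(z)$ are real. Moreover, if $\nu\ge 0$, then $2^{\nu}z^{\nu+n}J_{-\nu}^{(n)}(2z)$ has at most $2[\nu]+2n$ complex zeros. In other words, if $n-2s-2<\nu<n-2s-1$ with $s\in\mathbb{N}_0$, then $J_\nu^{(n)}(z)$ has at most $4s+2$ complex zeros; while if $n-2s-1<\nu<n-2s$ with $s\in\mathbb{N}$, then $J_\nu^{(n)}(z)$ has at most $4s$ complex zeros.
   Context: $J_\nu(z)=\sum_{m\ge 0}\frac{(-1)^m (z/2)^{2m+\nu}}{m!\,\Gamma(\nu+m+1)}$ is the Bessel function of the first kind of order $\nu$, and $J_\nu^{(n)}$ is its $n$-th derivative; $J_{-\nu}^{(n)}(2z)$ denotes the value of $J_{-\nu}^{(n)}$ at the point $2z$. The zeros of $J_\nu^{(n)}(z)$ are understood as the zeros of the even entire function $z^{n-\nu}J_\nu^{(n)}(z)$ (and $z^{\nu+n}J_{-\nu}^{(n)}(2z)$ is likewise an entire function). ''Complex zeros'' means nonreal zeros, counted with multiplicity. $[x]$ denotes the integer part (floor) of $x$; $\mathbb{N}=\{1,2,\dots\}$ and $\mathbb{N}_0=\{0,1,2,\dots\}$. *)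

(* Defs.v *)
From HB Require Import structures.
From mathcomp Require Import all_boot all_order all_algebra.
From mathcomp Require Import complex.
From mathcomp Require Import all_classical all_reals all_analysis.

Set Implicit Arguments.
Unset Strict Implicit.
Unset Printing Implicit Defensive.

Import Order.TTheory GRing.Theory Num.Theory.
Import numFieldNormedType.Exports.

Local Open Scope classical_set_scope.
Local Open Scope ring_scope.
Local Open Scope complex_scope.

(* The library equips R[i]^o, but not R[i] itself, with the topology and the
   normed R[i]-module structure given by the modulus. *)
HB.instance Definition _ (R : realType) := NormedModule.copy R[i] R[i]^o.

Definition euler_integral (R : realType) (x : R) : R :=
  (\int[lebesgue_measure]_(t in `]0%R, +oo[) (t `^ (x - 1) * expR (- t)))%R.

(* For x <= 0 this is Gamma (x + k) / (x (x + 1) ... (x + k - 1)), where k is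
   the least positive integer such that x + k > 0.  At the poles
   x = 0, -1, -2, ... the convention 0^-1 = 0 gives Gamma x = 0, hence
   (Gamma x)^-1 = 0, the value there of the entire function 1 / Gamma. *)
Definition Gamma (R : realType) (x : R) : R :=
  if 0 < x then euler_integral x else
  let k := (Num.truncn (- x)).+1 in
  euler_integral (x + k%:R) / \prod_(i < k) (x + i%:R).

Definition slit_plane (R : realType) : set R[i] :=
  [set z | ~ (complex.Im z = 0 /\ complex.Re z <= 0)].

(* Principal argument, with values in ]-pi, pi] for z != 0. *)
Definition Arg (R : realType) (z : R[i]) : R :=
  let t := acos (complex.Re z / complex.Re `|z|) in
  if 0 <= complex.Im z then t else - t.

(* Principal branch of z^a = exp (a Log z) for a real exponent a. *)
Definition cpow (R : realType) (z : R[i]) (a : R) : R[i] :=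
  (complex.Re `|z| `^ a)%:C * (cos (a * Arg z) +i* sin (a * Arg z)).

Definition besselJ (R : realType) (nu : R) (z : R[i]) : R[i] :=
  limn (series (fun m : nat =>
    (-1) ^+ m * cpow (z / 2) (2 * m%:R + nu)
      / ((m`!)%:R * Gamma (nu + m%:R + 1))%:C)).

(* The scalar field is R[i], so derivability is complex differentiability. *)
Definition entire (R : realType) (F : R[i] -> R[i]) : Prop :=
  forall z, derivable F z 1.

(* The slit plane is dense, so F is determined by f. *)
Definition entire_extension (R : realType) (f F : R[i] -> R[i]) : Prop :=
  entire F /\ forall z, slit_plane z -> F z = f z.

Definition vanishes_to_order (R : realType) (F : R[i] -> R[i]) (z : R[i])
    (m : nat) : Prop :=
  forall j, (j < m)%N -> derive1n j F z = 0.

(* Zeros are counted with multiplicity: a list of zeros may repeat z as many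
   times as the order of vanishing of F at z. *)
Definition at_most_nonreal_zeros (R : realType) (F : R[i] -> R[i]) (N : nat)
    : Prop :=
  forall l : seq R[i],
    (forall z, z \in l ->
       complex.Im z != 0 /\ vanishes_to_order F z (count_mem z l)) ->
    (size l <= N)%N.

(* Main.v *)
(* With w = z^2 / 4 and up to a constant factor, z^(n - nu) J_nu^(n)(z) is
     f(w) = sum_m (-w)^m p(m) / (m! Gamma(nu + m + 1)),
     p(m) = prod_(j < n) (2 m + nu - j).
   By Gauss's formula f is a limit of rescaled polynomials obtained from
   (1 - w)^T by multiplying the m-th coefficient successively by m + c, that is,
   by the operators w d/dw + c, where c runs (up to scaling) through
   nu - n + 1, nu - n + 2, nu - n + 3, ...  As w^(1 - c) d/dw (w^c q(w)) is the
   image of q, Rolle's theorem shows that an operator with c > 0 preserves the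
   number of zeros in ]0, 1], while any other one costs at most one zero.  If
   nu > n - k - 1, then at most k of the constants are not positive, so each
   polynomial has at most k zeros outside [0, +oo[.  A compactness argument
   transfers this to f, and each zero w of f outside [0, +oo[ accounts for two
   nonreal zeros z, whence the bound 2 k.  All four claims are instances:
   k = 0, k = [nu] + n for -nu, k = 2 s + 1 and k = 2 s. *)
Require Import Defs.
From HB Require Import structures.
From mathcomp Require Import all_boot all_order all_algebra.
From mathcomp Require Import complex.
From mathcomp Require Import all_classical all_reals all_analysis measurable_realfun.
From mathcomp Require Import ring lra zify.

Import Order.TTheory GRing.Theory Num.Theory.
Import numFieldNormedType.Exports.
Local Open Scope classical_set_scope.
Local Open Scope ring_scope.
Local Open Scope complex_scope.

Set Implicit Arguments.
Unset Strict Implicit.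
Unset Printing Implicit Defensive.

(** * Zeros in the unit interval of the multiplied binomial polynomials *)

(** Multiplicities shape the passage to the limit. They are kept by producing the limit in factored
    form: [w ^+ r], times [k] factors [1 - b w], times a power series without zeros off [0, +oo[.
    Counting zeros then becomes counting factors. Factors carry the reciprocals [b] of the zeros, so
    they stay meaningful when zeros escape to infinity and [b] tends to 0. The quantity under
    control is the sum of the reciprocals of the positive zeros: it dominates all coefficients of
    their product and, off [0, +oo[, keeps this product away from 0 whatever the number of factors.
    The number [T] of operators equals the degree, so that the zero 1 of multiplicity [T] is used up
    exactly; the constants that may fail to be positive come first, before any zero has been gained.
    The Gamma function enters through the recurrence and the positivity of its reciprocal. These fix
    all its values needed here from a single one, and the quotients in Gauss's formula obey the same
    recurrence up to a factor tending to 1. *)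

Section Rolle.
Variable R : realType.
Implicit Types (p : {poly R}) (c : R) (s : seq R).

Definition euler_op c p := c *: p + 'X * p^`().

(** At the left end 0 it is the factor [x ^ c] of the auxiliary function that vanishes, hence
    [0 < c] there; at a positive left end a root of [p] serves, for any [c]. *)
Lemma rolle_euler_op c p (a b : R) : 0 <= a < b -> (if a == 0 then 0 < c else root p a) ->
  root p b -> exists2 y, a < y < b & root (euler_op c p) y.
Proof.
move=> /andP[a0 ab] ha /rootP hb.
pose h (x : R) : R := x `^ c * p.[x].
have dh (x : R) : 0 < x -> is_derive x (1 : R) h (x `^ (c - 1) * (euler_op c p).[x]).
  move=> x0.
  have d1 : is_derive x (1 : R) (fun x : R => x `^ c) (c * x `^ (c - 1)) by exact: is_derive1_powR.
  have d2 : is_derive x (1 : R) (horner p) p^`().[x] by exact: is_derive_poly.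
  apply: is_derive_eq (is_deriveM d1 d2) _.
  rewrite /euler_op hornerD hornerZ hornerM hornerX /= /GRing.scale /=.
  rewrite (_ : x `^ c = x `^ (c - 1) * x); last first.
    by rewrite -{3}(powRr1 (ltW x0)) -powRD ?subrK// (gt_eqF x0) implybT.
  ring.
have ch (x : R) : 0 < x -> h @ x --> h x.
  move=> x0; apply: differentiable_continuous; apply/derivable1_diffP.
  by have [] := dh _ x0.
have [y yab Hy] : exists2 y, y \in `]a, b[ & is_derive y (1:R) h 0.
  apply: Rolle => //.
  - move=> x; rewrite in_itv /= => /andP[ax _]; have x0 : 0 < x by exact: le_lt_trans ax.
    by have [] := dh _ x0.
  - apply/(continuous_within_itvP _ ab); split.
    + move=> x; rewrite in_itv /= => /andP[ax _].
      exact: ch (le_lt_trans a0 ax).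
    + have [a0'|] := eqVneq a 0; last by move=> an0; apply: cvg_at_right_filter; apply: ch; rewrite lt_neqAle eq_sym an0.
      rewrite a0' eqxx in ha *.
      rewrite /h powR0 ?gt_eqF//.
      apply: cvgM; first exact: powR_cvg0.
      apply: cvg_at_right_filter; exact: continuous_horner.
    + apply: cvg_at_left_filter.
      exact: ch (le_lt_trans a0 ab).
  - rewrite /h hb mulr0; case: eqP ha => [->|_ /rootP ->]; last by rewrite mulr0.
    by move=> c0; rewrite powR0 ?mul0r// gt_eqF.
move: yab; rewrite in_itv /= => yab; exists y => //.
have /andP[ay _] := yab.
have e : y `^ (c - 1) * (euler_op c p).[y] = 0.
  rewrite -(@derive_val _ _ _ _ _ _ _ Hy); symmetry; apply: (@derive_val _ _ _ _ _ _ _ (dh _ _)).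
  exact: le_lt_trans ay.
move/eqP: e; rewrite mulf_eq0 => /orP[|//].
by rewrite gt_eqF// powR_gt0//; exact: le_lt_trans ay.
Qed.

(** The new zeros interlace with [a :: s]; the bound by [last a s] keeps them below 1 when the last
    old zero is 1. *)
Lemma rolle_euler_op_path c p (a : R) s : 0 <= a -> (if a == 0 then 0 < c else root p a) ->
  path <%R a s -> all (root p) s ->
  exists t, [/\ size t = size s, path <%R a t, all (root (euler_op c p)) t &
                all (fun y => y < last a s) t].
Proof.
elim: s a => [|b s IH] a a0 ha; first by exists [::].
move=> /= /andP[ab bs] /andP[rb rs].
have [y /andP[ay yb] ry] := @rolle_euler_op c p a b (introT andP (conj a0 ab)) ha rb.
have b0 : 0 < b by exact: le_lt_trans ab.
have [|t [t1 t2 t3 t4]] := IH b (ltW b0) _ bs rs; first by rewrite gt_eqF.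
exists (y :: t); split => /=.
- by rewrite t1.
- rewrite ay /=; case: t t2 {t1 t3 t4} => //= z t /andP[bz ->]; rewrite andbT; exact: lt_trans bz.
- by rewrite ry.
rewrite t4 andbT; apply: (lt_le_trans yb).
have : path <=%R b s by apply: sub_path bs => u v /ltW.
move/(order_path_min le_trans) => /allP H.
by have := mem_last b s; rewrite inE => /predU1P[->|/H].
Qed.

Lemma dvdp_euler_op c p (q : {poly R}) t : q ^+ t.+1 %| p -> q ^+ t %| euler_op c p.
Proof.
move=> /dvdpP[u ->]; rewrite /euler_op derivM deriv_exp.
rewrite -mul_polyC [q ^+ t.+1.-1]/= exprS.
rewrite -mulr_natl.
have -> : c%:P * (u * (q * q ^+ t)) + 'X * (u^`() * (q * q ^+ t) + u * (t.+1%:R * (q^`() * q ^+ t))) =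
  (c%:P * (u * q) + 'X * (u^`() * q + u * (t.+1%:R * q^`()))) * q ^+ t by ring.
exact: dvdp_mull.
Qed.

Variables (T k : nat) (c : nat -> R).

(** Given by its coefficients rather than by iterating the operators, because these coefficients are
    what is compared with the Bessel series. *)
Definition weighted_binom j : {poly R} :=
  \poly_(m < T.+1) ((-1) ^+ m * 'C(T, m)%:R * \prod_(i < j) (m%:R + c i)).

Lemma weighted_binom0 : weighted_binom 0 = (1 - 'X) ^+ T.
Proof.
apply/polyP => m; rewrite coef_poly big_ord0 mulr1 exprBn coef_sum.
under eq_bigr => i _.
  rewrite expr1n mulr1 coefMn -(rmorphN1 polyC) -rmorphXn coefCM coefXn.
  over.
case: ltnP => mT.
  rewrite (bigD1 (Ordinal mT)) //= eqxx mulr1 mulr_natr big1 ?addr0// => i im.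
  by rewrite (negPf (_ : m != i)) ?mulr0 ?mul0rn// eq_sym.
by rewrite big1// => i _; rewrite gtn_eqF ?mulr0 ?mul0rn//; exact: leq_trans mT.
Qed.

Lemma weighted_binomS j : weighted_binom j.+1 = euler_op (c j) (weighted_binom j).
Proof.
apply/polyP => m; rewrite /euler_op coefD coefZ coefXM coef_deriv !coef_poly.
case: m => [|m] /=; first by rewrite big_ord_recr /=; ring.
rewrite ltnS; case: ltnP => _; last by rewrite mul0rn; ring.
by rewrite big_ord_recr /= -[in RHS]mulr_natl; ring.
Qed.

Hypothesis cpos : forall i, (k <= i < T)%N -> 0 < c i.

(* Each operator lowers the multiplicity of the zero 1.  If its constant c j is
   positive, then Rolle's theorem on [0, 1] makes up for it with one more zero
   in ]0, 1[; no zero in ]0, 1[ is claimed for the first k operators. *)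
Lemma weighted_binom_roots j : (j <= T)%N -> exists s,
  [/\ size s = (j - k)%N, path <%R 0 s, all (fun y => y < 1) s,
      all (root (weighted_binom j)) s & (1 - 'X) ^+ (T - j) %| weighted_binom j].
Proof.
elim: j => [|j IH] jT.
  by exists [::]; split; rewrite // weighted_binom0 subn0.
have [s [s1 s2 s3 s4 s5]] := IH (ltnW jT).
have d : (1 - 'X) ^+ (T - j.+1) %| weighted_binom j.+1.
  by rewrite weighted_binomS; apply: dvdp_euler_op; rewrite -subSn.
case: (ltnP j k) => jk.
  by exists [::]; split => //; apply/esym/eqP; rewrite subn_eq0.
(* As long as [j < T], a power of [1 - 'X] remains, so 1 closes the chain of zeros on the right. *)
have r1 : root (weighted_binom j) 1.
  have : (1 - 'X) %| weighted_binom j.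
    apply: dvdp_trans s5; rewrite -subnSK// exprS; exact: dvdp_mulIl.
  by case/dvdpP => u ->; rewrite /root !hornerE subrr mulr0.
have [||||t [t1 t2 t3 t4]] := @rolle_euler_op_path (c j) (weighted_binom j) 0 (rcons s 1).
- by [].
- by rewrite eqxx; apply: cpos; rewrite jk.
- rewrite rcons_path s2 /=; have := mem_last 0 s; rewrite inE => /predU1P[->//|].
  by move/(allP s3).
- by rewrite all_rcons s4 r1.
exists t; split => //.
- by rewrite t1 size_rcons s1 subSn.
- by rewrite last_rcons in t4.
by rewrite weighted_binomS.
Qed.

(** The [T - k] zeros in ]0, 1[ are distinct, so their linear factors divide a polynomial of degree
    at most [T] and leave a cofactor of degree at most [k]. *)
Lemma weighted_binom_factor : exists s (q : {poly R}),
  [/\ weighted_binom T = q * \prod_(a <- s) ('X - a%:P), all (fun a => 0 < a) s & (size q <= k.+1)%N].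
Proof.
have [s [s1 s2 s3 s4 _]] := weighted_binom_roots (leqnn T).
have s0 : all (fun a => 0 < a) s by exact: order_path_min lt_trans s2.
have us : uniq s.
  apply: (@sorted_uniq _ <%R); [exact: lt_trans|exact: ltxx|exact: path_sorted s2].
have /dvdpP[q Hq] : \prod_(a <- s) ('X - a%:P) %| weighted_binom T.
  by apply: uniq_roots_dvdp => //; rewrite uniq_rootsE.
exists s, q; split => //.
have [->|q0] := eqVneq q 0; first by rewrite size_poly0.
have : (size (weighted_binom T) <= T.+1)%N by exact: size_poly.
rewrite Hq size_Mmonic ?monic_prod_XsubC// size_prod_XsubC s1 addnS /=.
move=> H; rewrite -(leq_add2r (T - k)); apply: leq_trans H _.
by rewrite addSn ltnS -leq_subLR.
Qed.
End Rolle.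

(** * Limits and power series in the complex plane *)

Section Modulus.
Variable R : realType.
Implicit Types (z w : R[i]) (x : R).

(** The norm of [R[i]] takes its values in [R[i]]; a real-valued modulus keeps estimates in the
    ordered field [R]. *)
Definition cmod z : R := Num.sqrt (complex.Re z ^+ 2 + complex.Im z ^+ 2).

Lemma normc_cmod z : `|z| = (cmod z)%:C.
Proof. by rewrite normc_def. Qed.
Lemma cmod_ge0 z : 0 <= cmod z.
Proof. exact: sqrtr_ge0. Qed.
Lemma cmod0 : cmod 0 = 0.
Proof. by rewrite /cmod /= expr0n addr0 sqrtr0. Qed.
Lemma cmodM z w : cmod (z * w) = cmod z * cmod w.
Proof. by apply: complexI; rewrite rmorphM /= -!normc_cmod normrM. Qed.
Lemma cmodD z w : cmod (z + w) <= cmod z + cmod w.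
Proof. by rewrite -lecR rmorphD /= -!normc_cmod ler_normD. Qed.
Lemma cmodN z : cmod (- z) = cmod z.
Proof. by apply: complexI; rewrite -!normc_cmod normrN. Qed.
Lemma cmodB z w : cmod (z - w) <= cmod z + cmod w.
Proof. by rewrite -[cmod w]cmodN cmodD. Qed.
Lemma cmodC z w : cmod (z - w) = cmod (w - z).
Proof. by rewrite -cmodN opprB. Qed.
Lemma cmod_eq0 z : (cmod z == 0) = (z == 0).
Proof.
by rewrite -[RHS]normr_eq0 normc_cmod -(inj_eq (@complexI R)).
Qed.
Lemma cmodV z : cmod z^-1 = (cmod z)^-1.
Proof. by apply: complexI; rewrite fmorphV /= -!normc_cmod normfV. Qed.
Lemma cmodX z n : cmod (z ^+ n) = cmod z ^+ n.
Proof. by apply: complexI; rewrite rmorphXn /= -!normc_cmod normrX. Qed.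
Lemma cmod_real x : cmod x%:C = `|x|.
Proof. by rewrite /cmod /= expr0n addr0 sqrtr_sqr. Qed.
Lemma cmod1 : cmod 1 = 1.
Proof. by rewrite -[1]/(1%:C) cmod_real normr1. Qed.
Lemma cmod_nat n : cmod n%:R = n%:R.
Proof. by rewrite -(rmorph_nat (real_complex R)) cmod_real normr_nat. Qed.
Lemma cmod_sqr z : cmod z ^+ 2 = complex.Re z ^+ 2 + complex.Im z ^+ 2.
Proof. by rewrite sqr_sqrtr// addr_ge0 ?sqr_ge0. Qed.
Lemma Re_le_cmod z : `|complex.Re z| <= cmod z.
Proof. by rewrite -sqrtr_sqr ler_wsqrtr// lerDl sqr_ge0. Qed.
Lemma Im_le_cmod z : `|complex.Im z| <= cmod z.
Proof. by rewrite -sqrtr_sqr ler_wsqrtr// lerDr sqr_ge0. Qed.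
Lemma cmod_gt0 z : (0 < cmod z) = (z != 0).
Proof. by rewrite lt_def cmod_eq0 cmod_ge0 andbT. Qed.
Lemma cmod_le_ReIm z : cmod z <= `|complex.Re z| + `|complex.Im z|.
Proof.
rewrite -[leRHS]ger0_norm ?addr_ge0// -sqrtr_sqr ler_wsqrtr//.
by rewrite sqrrD !real_normK ?num_real// addrAC lerDl mulrn_wge0// mulr_ge0.
Qed.
Lemma cmod_sum (I : Type) (s : seq I) (P : pred I) (f : I -> R[i]) :
  cmod (\sum_(i <- s | P i) f i) <= \sum_(i <- s | P i) cmod (f i).
Proof.
elim/big_ind2 : _ => //; first by rewrite cmod0.
by move=> a b c d h1 h2; apply: le_trans (cmodD _ _) _; exact: lerD.
Qed.
Lemma ReD z w : complex.Re (z + w) = complex.Re z + complex.Re w.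
Proof. by case: z w => [? ?] [? ?]. Qed.
Lemma ImD z w : complex.Im (z + w) = complex.Im z + complex.Im w.
Proof. by case: z w => [? ?] [? ?]. Qed.
Lemma ReN z : complex.Re (- z) = - complex.Re z.
Proof. by case: z. Qed.
Lemma ImN z : complex.Im (- z) = - complex.Im z.
Proof. by case: z. Qed.
Lemma ReM z w : complex.Re (z * w) =
  complex.Re z * complex.Re w - complex.Im z * complex.Im w.
Proof. by case: z w => [? ?] [? ?]. Qed.
Lemma ImM z w : complex.Im (z * w) =
  complex.Re z * complex.Im w + complex.Im z * complex.Re w.
Proof. by case: z w => [? ?] [? ?]. Qed.
Lemma complex_eqP z w : complex.Re z = complex.Re w -> complex.Im z = complex.Im w -> z = w.
Proof. by case: z w => [? ?] [? ?] /= -> ->. Qed.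
Lemma Re_sum (I : Type) (s : seq I) (P : pred I) (f : I -> R[i]) :
  complex.Re (\sum_(i <- s | P i) f i) = \sum_(i <- s | P i) complex.Re (f i).
Proof. by elim/big_ind2 : _ => // a b c d <- <-; rewrite ReD. Qed.
Lemma Im_sum (I : Type) (s : seq I) (P : pred I) (f : I -> R[i]) :
  complex.Im (\sum_(i <- s | P i) f i) = \sum_(i <- s | P i) complex.Im (f i).
Proof. by elim/big_ind2 : _ => // a b c d <- <-; rewrite ImD. Qed.
End Modulus.

Section ComplexLimits.
Variables (R : realType) (T : Type) (F : set_system T).
Context {FF : ProperFilter F}.
Implicit Types (u v : T -> R[i]) (l : R[i]).

(** The filter is arbitrary because limits are taken both along [\oo] and along the ultrafilter of
    the compactness argument. *)
Definition clim u l :=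
  (fun x => complex.Re (u x)) @ F --> complex.Re l /\
  (fun x => complex.Im (u x)) @ F --> complex.Im l.

Lemma clim_cst l : clim (fun=> l) l.
Proof. split; exact: cvg_cst. Qed.

Lemma climD u v l l' : clim u l -> clim v l' -> clim (fun x => u x + v x) (l + l').
Proof.
move=> [u1 u2] [v1 v2]; split.
  rewrite ReD (_ : (fun x => _) = (fun x => complex.Re (u x)) + (fun x => complex.Re (v x))); first exact: cvgD.
  by apply/funext => x /=; rewrite ReD.
rewrite ImD (_ : (fun x => _) = (fun x => complex.Im (u x)) + (fun x => complex.Im (v x))); first exact: cvgD.
by apply/funext => x /=; rewrite ImD.
Qed.

Lemma climM u v l l' : clim u l -> clim v l' -> clim (fun x => u x * v x) (l * l').
Proof.
move=> [u1 u2] [v1 v2]; split.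
  rewrite ReM (_ : (fun x => _) = (fun x => complex.Re (u x)) * (fun x => complex.Re (v x)) -
    (fun x => complex.Im (u x)) * (fun x => complex.Im (v x))); first by apply: cvgB; apply: cvgM.
  by apply/funext => x /=; rewrite ReM.
rewrite ImM (_ : (fun x => _) = (fun x => complex.Re (u x)) * (fun x => complex.Im (v x)) +
    (fun x => complex.Im (u x)) * (fun x => complex.Re (v x))); first by apply: cvgD; apply: cvgM.
by apply/funext => x /=; rewrite ImM.
Qed.

Lemma climB u v l l' : clim u l -> clim v l' -> clim (fun x => u x - v x) (l - l').
Proof.
move=> ul vl; under eq_fun do rewrite -mulN1r.
rewrite -(mulN1r l'); apply: climD => //; apply: climM => //; exact: clim_cst.
Qed.

Lemma clim_sum (I : Type) (s : seq I) (u : I -> T -> R[i]) (l : I -> R[i]) :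
  (forall i, clim (u i) (l i)) -> clim (fun x => \sum_(i <- s) u i x) (\sum_(i <- s) l i).
Proof.
move=> H; elim: s => [|i s IH].
  by rewrite big_nil; under eq_fun do rewrite big_nil; exact: clim_cst.
by rewrite big_cons; under eq_fun do rewrite big_cons; exact: climD.
Qed.

Lemma clim_near u v l : clim u l -> (\forall x \near F, u x = v x) -> clim v l.
Proof.
move=> [u1 u2] uv; split.
  by apply: cvg_trans u1; apply: near_eq_cvg; apply: filterS uv => x /= ->.
by apply: cvg_trans u2; apply: near_eq_cvg; apply: filterS uv => x /= ->.
Qed.

Lemma clim_cmod u l : clim u l -> (fun x => cmod (u x)) @ F --> cmod l.
Proof.
move=> [u1 u2].
have H : (fun x => complex.Re (u x) ^+ 2 + complex.Im (u x) ^+ 2) @ F -->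
    complex.Re l ^+ 2 + complex.Im l ^+ 2.
  by apply: cvgD; apply: cvgM.
exact: (continuous_cvg _ (@sqrt_continuous R _) H).
Qed.

Lemma clim_le u l (C : R) : clim u l -> (\forall x \near F, cmod (u x) <= C) -> cmod l <= C.
Proof. by move=> /clim_cmod ul uC; exact: (cvgr_to_le ul). Qed.

Lemma clim_ge u l (C : R) : clim u l -> (\forall x \near F, C <= cmod (u x)) -> C <= cmod l.
Proof. by move=> /clim_cmod ul uC; exact: (cvgr_to_ge ul). Qed.

Lemma clim_eps u l : (forall e : R, 0 < e -> \forall x \near F, cmod (u x - l) <= e) -> clim u l.
Proof.
move=> H; split; apply/cvgrPdist_le => e e0; apply: filterS (H e e0) => x; apply: le_trans.
  by rewrite distrC /= -ReN -ReD Re_le_cmod.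
by rewrite distrC /= -ImN -ImD Im_le_cmod.
Qed.

Lemma clim_epsP u l e : clim u l -> 0 < e -> \forall x \near F, cmod (u x - l) <= e.
Proof.
move=> ul e0; have /clim_cmod : clim (fun x => u x - l) 0.
  by rewrite -(subrr l); apply: climB => //; exact: clim_cst.
move/cvgr_le; apply.
by rewrite cmod0.
Qed.

Lemma clim_unique u l l' : clim u l -> clim u l' -> l = l'.
Proof.
move=> [u1 u2] [v1 v2]; apply: complex_eqP.
  by exact: (cvg_unique (@Rhausdorff R) u1 v1).
by exact: (cvg_unique (@Rhausdorff R) u2 v2).
Qed.
End ComplexLimits.

(** * Power series of exponential type *)

Section PowerSeries.
Variable R : realType.
Implicit Types (a b : nat -> R[i]) (w z h : R[i]) (x : R).

Lemma exp_series_le x n : 0 <= x -> \sum_(0 <= m < n) x ^+ m / m`!%:R <= expR x.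
Proof.
move=> x0; apply: (@nondecreasing_cvgn_le _ (series (exp_coeff x))).
  by apply/nondecreasing_seqP => m; rewrite seriesSr lerDl divr_ge0// exprn_ge0.
exact: is_cvg_series_exp_coeff.
Qed.

Definition exp_tail x n := expR x - \sum_(0 <= m < n) x ^+ m / m`!%:R.

Lemma exp_tail_cvg x : exp_tail x @ \oo --> (0 : R).
Proof.
rewrite -(subrr (expR x)); apply: cvgB; first exact: cvg_cst.
exact: is_cvg_series_exp_coeff.
Qed.

(** The growth of an entire function of exponential type: every estimate becomes a comparison with
    the series of [expR], and the condition survives shifts and differentiation. *)
Definition exp_bounded a (K B : R) := forall m, cmod (a m) <= K * (B ^+ m / m`!%:R).

Definition exp_type a := exists K B, [/\ 0 <= K, 0 <= B & exp_bounded a K B].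

Definition psum a w : R[i] :=
  limn (series (fun m => complex.Re (a m * w ^+ m))) +i*
  limn (series (fun m => complex.Im (a m * w ^+ m))).

Lemma exp_type_ge0 a K B : exp_bounded a K B -> 0 <= B -> 0 <= K.
Proof.
by move=> /(_ 0%N) + _; rewrite expr0 fact0 divr1 mulr1; apply: le_trans; exact: cmod_ge0.
Qed.

Lemma psum_term_le a w K B m : exp_bounded a K B -> 0 <= B ->
  cmod (a m * w ^+ m) <= K * ((B * cmod w) ^+ m / m`!%:R).
Proof.
move=> aKB B0; rewrite cmodM cmodX exprMn mulrAC mulrA.
by apply: ler_wpM2r; [rewrite exprn_ge0// cmod_ge0|exact: aKB].
Qed.

Lemma psum_lim a w : exp_type a -> clim \oo (fun n => \sum_(0 <= m < n) a m * w ^+ m) (psum a w).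
Proof.
move=> [K [B [K0 B0 aKB]]].
have cv (u : nat -> R) : (forall m, `|u m| <= cmod (a m * w ^+ m)) -> cvgn (series u).
  move=> H; apply: normed_cvg; apply: (@series_le_cvg _ _ (fun m => K * exp_coeff (B * cmod w) m)).
  - by move=> m /=.
  - by move=> m; rewrite mulr_ge0// /exp_coeff /= divr_ge0// exprn_ge0// mulr_ge0// cmod_ge0.
  - by move=> m; apply: le_trans (H m) _; exact: psum_term_le.
  - exact: is_cvg_seriesZ (is_cvg_series_exp_coeff _).
split=> /=.
  under eq_fun do rewrite Re_sum.
  by apply: cv => m; exact: Re_le_cmod.
under eq_fun do rewrite Im_sum.
by apply: cv => m; exact: Im_le_cmod.
Qed.

Lemma psum_tail a w K B n : exp_bounded a K B -> 0 <= B ->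
  cmod (psum a w - \sum_(0 <= m < n) a m * w ^+ m) <= K * exp_tail (B * cmod w) n.
Proof.
move=> aKB B0; have K0 := exp_type_ge0 aKB B0.
have /psum_lim - /(_ w) L : exp_type a by exists K, B.
apply: (clim_le (climB L (clim_cst _))).
near=> N.
have nN : (n <= N)%N by near: N; exact: nbhs_infty_ge.
have -> : \sum_(0 <= m < N) a m * w ^+ m - \sum_(0 <= m < n) a m * w ^+ m =
    \sum_(n <= m < N) a m * w ^+ m.
  by apply/eqP; rewrite subr_eq addrC -big_cat_nat.
apply: le_trans (cmod_sum _ _ _) _.
apply: (@le_trans _ _ (\sum_(n <= m < N) K * ((B * cmod w) ^+ m / m`!%:R))).
  by apply: ler_sum => m _; exact: psum_term_le.
rewrite -mulr_sumr ler_wpM2l// /exp_tail lerBrDl -big_cat_nat//=.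
by rewrite exp_series_le// mulr_ge0// cmod_ge0.
Unshelve. all: by end_near. Qed.

Definition pshift a m := if m is m'.+1 then a m' else 0.
Definition pderiv a m := m.+1%:R * a m.+1.

Lemma exp_typeD a b : exp_type a -> exp_type b -> exp_type (fun m => a m + b m).
Proof.
move=> [K [B [K0 B0 aKB]]] [K' [B' [K'0 B'0 bKB]]].
exists (K + K'), (Num.max B B'); split; [exact: addr_ge0|by rewrite le_max B0|].
move=> m; apply: le_trans (cmodD _ _) _; rewrite mulrDl lerD//.
  apply: le_trans (aKB m) _; rewrite ler_wpM2l// ler_wpM2r// lerXn2r ?nnegrE ?le_max ?B0 ?lexx//.
apply: le_trans (bKB m) _; rewrite ler_wpM2l// ler_wpM2r// lerXn2r ?nnegrE ?le_max ?B0 ?lexx ?orbT//.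
Qed.

Lemma exp_typeM (c : R[i]) a : exp_type a -> exp_type (fun m => c * a m).
Proof.
move=> [K [B [K0 B0 aKB]]]; exists (cmod c * K), B; split=> //.
  by rewrite mulr_ge0// cmod_ge0.
by move=> m; rewrite cmodM -mulrA ler_wpM2l ?cmod_ge0//; exact: aKB.
Qed.

Lemma exp_type_pderiv a : exp_type a -> exp_type (pderiv a).
Proof.
move=> [K [B [K0 B0 aKB]]]; exists (K * B), B; split => //; first exact: mulr_ge0.
move=> m; rewrite /pderiv cmodM cmod_nat.
apply: le_trans (ler_wpM2l _ (aKB m.+1)) _ => //.
rewrite exprS factS natrM invfM.
rewrite (_ : _ * (K * _) = K * B * (B ^+ m / m`!%:R) * (m.+1%:R * m.+1%:R^-1)); last by ring.
by rewrite mulfV// mulr1.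
Qed.

Lemma exp_type_succ a : exp_type a -> exp_type (fun m => a m.+1).
Proof.
move=> [K [B [K0 B0 aKB]]]; exists (K * B), B; split => //; first exact: mulr_ge0.
move=> m; apply: le_trans (aKB m.+1) _; rewrite exprS -!mulrA !ler_wpM2l ?exprn_ge0//.
rewrite lef_pV2 ?posrE ?ltr0n ?fact_gt0// ler_nat.
by rewrite factS leq_pmull.
Qed.

Lemma exp_type_pshift a : exp_type a -> exp_type (pshift a).
Proof.
(* Shifting costs a factor m + 1, at most 2 ^ m; the summand 1 makes the base at least 1, so one
   more power of it does no harm. *)
move=> [K [B [K0 B0 aKB]]]; exists K, (2 * B + 1); split => //.
  by rewrite addr_ge0// mulr_ge0.
case=> [|m] /=; first by rewrite cmod0 expr0 fact0 divr1 mulr1.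
apply: le_trans (aKB m) _; rewrite ler_wpM2l// factS natrM invfM mulrA.
rewrite ler_wpM2r ?invr_ge0 ?ler0n// ler_pdivlMr// mulrC exprS.
have B1 : B <= 2 * B + 1 by lra.
have m2 : m.+1%:R * B ^+ m <= (2 * B + 1) ^+ m.
  apply: (@le_trans _ _ ((2 * B) ^+ m)).
    by rewrite exprMn ler_wpM2r ?exprn_ge0// -natrX ler_nat ltn_expl.
  by rewrite lerXn2r// ?nnegrE; lra.
apply: le_trans m2 _; rewrite ler_peMl ?exprn_ge0//; lra.
Qed.

Lemma psumD a b w : exp_type a -> exp_type b ->
  psum (fun m => a m + b m) w = psum a w + psum b w.
Proof.
move=> ha hb; apply: (clim_unique (psum_lim w (exp_typeD ha hb))).
apply: (clim_near (climD (psum_lim w ha) (psum_lim w hb))).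
by near=> n; rewrite -big_split /=; apply: eq_bigr => m _; rewrite mulrDl.
Unshelve. all: by end_near. Qed.

Lemma psumM (c : R[i]) a w : exp_type a -> psum (fun m => c * a m) w = c * psum a w.
Proof.
move=> ha; apply: (clim_unique (psum_lim w (exp_typeM c ha))).
apply: (clim_near (climM (clim_cst c) (psum_lim w ha))).
by near=> n; rewrite mulr_sumr; apply: eq_bigr => m _; rewrite mulrA.
Unshelve. all: by end_near. Qed.

Lemma climS (u : nat -> R[i]) l : clim \oo u l -> clim \oo (fun n => u n.+1) l.
Proof.
move=> [u1 u2]; split.
  by move: u1; rewrite -(cvg_shiftS (fun n => complex.Re (u n))).
by move: u2; rewrite -(cvg_shiftS (fun n => complex.Im (u n))).
Qed.

Lemma psum_pshift a w : exp_type a -> psum (pshift a) w = w * psum a w.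
Proof.
move=> ha; apply: (clim_unique (climS (psum_lim w (exp_type_pshift ha)))).
apply: (clim_near (climM (clim_cst w) (psum_lim w ha))).
near=> n; rewrite mulr_sumr big_nat_recl//= mul0r add0r.
by apply: eq_bigr => m _; rewrite exprS; ring.
Unshelve. all: by end_near. Qed.

Lemma eq_psum a b w : a =1 b -> psum a w = psum b w.
Proof. by move=> /funext ->. Qed.
End PowerSeries.

(** * Complex derivatives *)

Section ComplexDerivative.
Variable R : realType.
Implicit Types (f g : R[i] -> R[i]) (z w h d : R[i]) (e r : R).

Definition cderiv f z d := forall e, 0 < e -> exists2 r, 0 < r &
  forall h, cmod h < r -> cmod (f (z + h) - f z - d * h) <= e * cmod h.

Lemma cderivP f z d : cderiv f z d <-> is_derive z (1 : R[i]) f d.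
Proof.
split=> [H|[df <-] e e0].
  suff C : (fun h => h^-1 *: (f (h *: 1 + z) - f z)) @ 0^' --> d.
    split; first by apply/cvg_ex; exists d.
    exact: cvg_lim C.
  apply/cvgrPdist_le => e e0.
  have e0' : 0 < complex.Re e by case: e e0 => a b /=; rewrite ltcE /= => /andP[].
  have eE : e = (complex.Re e)%:C by rewrite RRe_real// ger0_real// ltW.
  have [r r0 Hr] := H _ e0'.
  near=> h.
  have hn0 : h != 0 by near: h; exact: nbhs_dnbhs_neq.
  have hd : cmod h < r.
    have : `|h| < r%:C by near: h; apply: dnbhs0_lt; rewrite ltcR.
    by rewrite normc_cmod ltcR.
  rewrite eE normc_cmod lecR [h *: 1]mulr1 [h + z]addrC cmodC /GRing.scale /=.
  have -> : h^-1 * (f (z + h) - f z) - d = h^-1 * (f (z + h) - f z - d * h).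
    by field.
  by rewrite cmodM cmodV mulrC ler_pdivrMr ?cmod_gt0// Hr.
have := df => /cvg_ex -[d0 Hd0].
have -> : 'D_1 f z = d0 by exact: cvg_lim Hd0.
move/cvgrPdist_le : Hd0 => /(_ e%:C); rewrite ltcR => /(_ e0).
rewrite near_withinE /= => /nbhs_ballP[r r0 Hr].
have r0' : 0 < complex.Re r by case: r r0 {Hr} => a b /=; rewrite ltcE /= => /andP[].
have rE : r = (complex.Re r)%:C by rewrite RRe_real// ger0_real// ltW.
exists (complex.Re r) => // h hr.
have [->|h0] := eqVneq h 0; first by rewrite addr0 subrr mulr0 subr0 cmod0 mulr0.
have := Hr h; rewrite -ball_normE /= sub0r normrN rE normc_cmod ltcR => /(_ hr h0).
rewrite normc_cmod lecR [h *: 1]mulr1 [h + z]addrC cmodC /GRing.scale /= => H.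
have -> : (f (z + h) - f z - d0 * h) = h * (h^-1 * (f (z + h) - f z) - d0) by field.
by rewrite cmodM mulrC ler_wpM2r// cmod_ge0.
Unshelve. all: by end_near. Qed.

Lemma cderiv_derive1 f z d : cderiv f z d -> derive1 f z = d.
Proof. by move=> /cderivP H; rewrite derive1E; exact: derive_val. Qed.

Lemma cderiv_derivable f z d : cderiv f z d -> derivable f z 1.
Proof. by move=> /cderivP[]. Qed.

Lemma cderiv_quadratic f z d e C : 0 < e -> 0 <= C ->
  (forall h, cmod h < e -> cmod (f (z + h) - f z - d * h) <= C * cmod h ^+ 2) -> cderiv f z d.
Proof.
move=> e0 C0 H e' e'0; exists (Num.min e (e' / (C + 1))).
  by rewrite lt_min e0 divr_gt0// ltr_wpDl.
move=> h; rewrite lt_min => /andP[he]; rewrite ltr_pdivlMr ?ltr_wpDl// => he'.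
apply: le_trans (H h he) _; rewrite expr2 mulrA ler_wpM2r ?cmod_ge0//.
have := cmod_ge0 h; lra.
Qed.

Lemma cderiv_cst (c : R[i]) z : cderiv (fun=> c) z 0.
Proof.
by move=> e e0; exists 1 => // h _; rewrite subrr mul0r subr0 cmod0 mulr_ge0 ?cmod_ge0// ltW.
Qed.

Lemma cderiv_id z : cderiv id z 1.
Proof.
move=> e e0; exists 1 => // h _; rewrite /= [z + h]addrC addrK mul1r subrr cmod0 mulr_ge0 ?cmod_ge0//.
exact: ltW.
Qed.

Lemma cderiv_eq f z d d' : cderiv f z d -> d = d' -> cderiv f z d'.
Proof. by move=> + <-. Qed.

Lemma cderivD f g z d d' : cderiv f z d -> cderiv g z d' ->
  cderiv (fun x => f x + g x) z (d + d').
Proof. by move=> /cderivP hf /cderivP hg; apply/cderivP; exact: is_deriveD. Qed.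

Lemma cderivM f g z d d' : cderiv f z d -> cderiv g z d' ->
  cderiv (fun x => f x * g x) z (d * g z + f z * d').
Proof.
move=> /(proj1 (cderivP _ _ _)) hf /(proj1 (cderivP _ _ _)) hg.
have -> : d * g z + f z * d' = f z * d' + g z * d by ring.
exact: (proj2 (cderivP (fun x => f x * g x) z (f z * d' + g z * d)) (is_deriveM hf hg)).
Qed.

Lemma cderiv_near f g z d r : 0 < r ->
  (forall h, cmod h < r -> f (z + h) = g (z + h)) -> cderiv f z d -> cderiv g z d.
Proof.
move=> r0 fg H e /H[r' r'0 Hr']; exists (Num.min r r'); first by rewrite lt_min r0.
move=> h; rewrite lt_min => /andP[h1 h2]; rewrite -fg//.
have := fg 0; rewrite cmod0 addr0 => <- //; exact: Hr'.
Qed.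

Lemma cderiv_comp f g z d d' : cderiv g z d -> cderiv f (g z) d' ->
  cderiv (fun x => f (g x)) z (d' * d).
Proof.
move=> Hg Hf e e0.
(* The errors of [g] and of [f] each receive [e / 2]; the bound [e1 <= 1] gives
   [cmod k <= (cmod d + 1) * cmod h]. *)
pose e1 := Num.min 1 (e / (2 * (cmod d' + 1))).
have d'0 : 0 < cmod d' + 1 by rewrite ltr_wpDl ?cmod_ge0.
have d0 : 0 < cmod d + 1 by rewrite ltr_wpDl ?cmod_ge0.
have e10 : 0 < e1 by rewrite lt_min ltr01 divr_gt0// mulr_gt0.
have [r1 r10 Hr1] := Hg e1 e10.
pose e2 := e / (2 * (cmod d + 1)).
have e20 : 0 < e2 by rewrite divr_gt0// mulr_gt0.
have [r2 r20 Hr2] := Hf e2 e20.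
exists (Num.min r1 (r2 / (cmod d + 1))).
  by rewrite lt_min r10 divr_gt0.
move=> h; rewrite lt_min => /andP[hr1]; rewrite ltr_pdivlMr// => hr2.
have {Hr1} H1 := Hr1 h hr1.
set k := g (z + h) - g z in H1 *.
have kE : cmod k <= (cmod d + 1) * cmod h.
  have -> : k = (k - d * h) + d * h by rewrite subrK.
  apply: le_trans (cmodD _ _) _; rewrite cmodM.
  have : e1 <= 1 by rewrite /e1 ge_min lexx.
  have := cmod_ge0 h; nra.
have {Hr2} := Hr2 k; rewrite [g z + k]addrC subrK => /(_ (le_lt_trans kE _)).
rewrite mulrC => /(_ hr2) H2.
have -> : f (g (z + h)) - f (g z) - d' * d * h =
  (f (g (z + h)) - f (g z) - d' * k) + d' * (k - d * h) by ring.
apply: le_trans (cmodD _ _) _.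
have -> : e = e2 * (cmod d + 1) + e / 2.
  by rewrite /e2; field; rewrite lt0r_neq0//.
rewrite mulrDl cmodM; apply: lerD.
  apply: le_trans H2 _; rewrite -mulrA ler_wpM2l//; exact: ltW.
apply: le_trans (_ : cmod d' * (e1 * cmod h) <= _); first by rewrite ler_wpM2l ?cmod_ge0.
rewrite mulrA ler_wpM2r ?cmod_ge0//.
have : e1 <= e / (2 * (cmod d' + 1)) by rewrite /e1 ge_min lexx orbT.
rewrite ler_pdivlMr ?mulr_gt0// => H3.
have := cmod_ge0 d'; nra.
Qed.

(** The factor m of the Taylor remainder is absorbed into powers of 4: a geometric bound, summed
    against an [exp_bounded] sequence, is again an exponential series. *)
Lemma expr_remainder_le z h m (rho : R) : cmod (z + h) <= rho -> cmod z <= rho -> 1 <= rho ->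
  cmod ((z + h) ^+ m - z ^+ m - m%:R * z ^+ m.-1 * h) <= (4 * rho) ^+ m * cmod h ^+ 2.
Proof.
move=> zh zr r1.
elim: m => [|m IH].
  by rewrite !expr0 subrr !mul0r subr0 cmod0 mulr_ge0// ?exprn_ge0// cmod_ge0.
case: m IH => [_|m IH].
  rewrite !expr1 [m in z ^+ m]/= expr0 mulr1 mul1r [z + h]addrC addrK subrr cmod0.
  by rewrite mulr_ge0 ?exprn_ge0 ?cmod_ge0//; lra.
have -> : (z + h) ^+ m.+2 - z ^+ m.+2 - m.+2%:R * z ^+ m.+2.-1 * h =
  (z + h) * ((z + h) ^+ m.+1 - z ^+ m.+1 - m.+1%:R * z ^+ m.+1.-1 * h) + m.+1%:R * z ^+ m * h ^+ 2.
  rewrite !succnK !exprS -[m.+2%:R]natr1; ring.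
apply: le_trans (cmodD _ _) _.
rewrite (cmodM (z + h)) (cmodM (m.+1%:R * _) (h ^+ 2)) (cmodM m.+1%:R) !cmodX cmod_nat.
have r0 : 0 <= rho by exact: le_trans ler01 r1.
apply: (@le_trans _ _ (rho * ((4 * rho) ^+ m.+1 * cmod h ^+ 2) + (4 * rho) ^+ m.+1 * cmod h ^+ 2)).
  apply: lerD; first by apply: ler_pM => //; exact: cmod_ge0.
  rewrite ler_wpM2r ?exprn_ge0 ?cmod_ge0// exprMn ler_pM ?exprn_ge0 ?cmod_ge0//.
    rewrite -natrX ler_nat; apply: ltnW; apply: (leq_trans (ltn_expl m.+1 (isT : 1 < 2)%N)).
    by rewrite leq_exp2r.
  by rewrite exprS (le_trans _ (ler_peMl _ r1)) ?exprn_ge0// lerXn2r ?nnegrE ?cmod_ge0.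
rewrite [in leRHS]exprS -!mulrA; set t := (4 * rho) ^+ m.+1 * _.
have t0 : 0 <= t by rewrite mulr_ge0 ?exprn_ge0 ?cmod_ge0// mulr_ge0.
nra.
Qed.

(** For [cmod h < 1] the remainders of the terms add up to at most
    [K * expR (B * (4 * rho)) * cmod h ^+ 2], uniformly in the truncation, where [rho] bounds both
    [z] and [z + h]. *)
Lemma cderiv_psum (a : nat -> R[i]) z : exp_type a -> cderiv (psum a) z (psum (pderiv a) z).
Proof.
move=> ha; have [K [B [K0 B0 aKB]]] := ha.
pose rho := cmod z + 1.
have rho0 : 0 <= rho by rewrite addr_ge0 ?cmod_ge0.
apply: (@cderiv_quadratic _ _ _ 1 (K * expR (B * (4 * rho)))) => //.
  by rewrite mulr_ge0 ?expR_ge0.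
move=> h h1.
apply: (clim_le (climB (climB (climS (psum_lim (z + h) ha)) (climS (psum_lim z ha)))
  (climM (psum_lim z (exp_type_pderiv ha)) (clim_cst h)))).
near=> n.
have -> : \sum_(0 <= m < n.+1) a m * (z + h) ^+ m - \sum_(0 <= m < n.+1) a m * z ^+ m -
    (\sum_(0 <= m < n) pderiv a m * z ^+ m) * h =
  \sum_(0 <= m < n.+1) a m * ((z + h) ^+ m - z ^+ m - m%:R * z ^+ m.-1 * h).
  rewrite -sumrB mulr_suml [LHS]addrC big_nat_recl// [in RHS]big_nat_recl//.
  rewrite !expr0 subrr add0r subrr !mul0r subr0 mulr0 add0r addrC -sumrB.
  apply: eq_bigr => i _; rewrite /pderiv succnK; ring.
apply: le_trans (cmod_sum _ _ _) _.
apply: (@le_trans _ _ (\sum_(0 <= m < n.+1) (K * cmod h ^+ 2) * ((B * (4 * rho)) ^+ m / m`!%:R))).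
  apply: ler_sum => m _; rewrite cmodM.
  apply: (@le_trans _ _ ((K * (B ^+ m / m`!%:R)) * ((4 * rho) ^+ m * cmod h ^+ 2))).
    apply: ler_pM; [exact: cmod_ge0|exact: cmod_ge0|exact: aKB|].
    apply: expr_remainder_le.
    - by apply: le_trans (cmodD _ _) _; rewrite lerD2l ltW.
    - by rewrite lerDl.
    - by rewrite lerDr cmod_ge0.
  by rewrite le_eqVlt; apply/orP; left; apply/eqP; rewrite [(B * _) ^+ m]exprMn; ring.
rewrite -mulr_sumr -mulrA [cmod h ^+ 2 * _]mulrC mulrA ler_wpM2r ?exprn_ge0 ?cmod_ge0//.
rewrite ler_wpM2l// exp_series_le// mulr_ge0// mulr_ge0//.
Unshelve. all: by end_near. Qed.
End ComplexDerivative.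

(** * Multiplicities of zeros *)

Section Multiplicity.
Variable R : realType.
Implicit Types (f g : R[i] -> R[i]) (z w : R[i]).

(** The successive derivatives are carried as functions on the whole plane, so that closure under
    products and composition follows by induction on [n]. *)
Fixpoint smooth n f : Prop :=
  if n is n'.+1 then exists f', (forall z, cderiv f z (f' z)) /\ smooth n' f' else True.

Lemma smoothW n f : smooth n.+1 f -> smooth n f.
Proof. by elim: n f => // n IH f [f' [Hf /IH Hf']]; exists f'. Qed.

Lemma smooth_cst n (c : R[i]) : smooth n (fun=> c).
Proof. by elim: n c => //= n IH c; exists (fun=> 0); split => // z; exact: cderiv_cst. Qed.

Lemma smooth_id n : smooth n id.
Proof. by case: n => //= n; exists (fun=> 1); split=> [z|]; [exact: cderiv_id|exact: smooth_cst]. Qed.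

Lemma smoothD n f g : smooth n f -> smooth n g -> smooth n (fun z => f z + g z).
Proof.
elim: n f g => //= n IH f g [f' [Hf Hf']] [g' [Hg Hg']].
exists (fun z => f' z + g' z); split=> [z|]; last exact: IH.
exact: cderivD.
Qed.

Lemma smoothM n f g : smooth n f -> smooth n g -> smooth n (fun z => f z * g z).
Proof.
elim: n f g => // n IH f g nf ng.
have [[f' [Hf Hf']] [g' [Hg Hg']]] := (nf, ng).
exists (fun z => f' z * g z + f z * g' z); split=> [z|]; first exact: cderivM.
by apply: smoothD; apply: IH => //; exact: smoothW.
Qed.

Lemma smooth_comp n f g : smooth n f -> smooth n g -> smooth n (fun z => f (g z)).
Proof.
elim: n f g => // n IH f g [f' [Hf Hf']] ng.
have [g' [Hg Hg']] := ng.
exists (fun z => f' (g z) * g' z); split=> [z|]; first exact: cderiv_comp.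
by apply: smoothM => //; apply: IH => //; exact: smoothW.
Qed.

Lemma smooth_psum n (a : nat -> R[i]) : exp_type a -> smooth n (psum a).
Proof.
elim: n a => //= n IH a ha; exists (psum (pderiv a)); split=> [z|]; first exact: cderiv_psum.
exact/IH/exp_type_pderiv.
Qed.

Lemma cderiv_expB j z0 z : cderiv (fun w => (w - z0) ^+ j) z (j%:R * (z - z0) ^+ j.-1).
Proof.
elim: j => [|j IH]; first by apply: cderiv_eq (cderiv_cst _ _) _; rewrite mul0r.
have H1 : cderiv (fun w => w - z0) z 1.
  by apply: cderiv_eq (cderivD (cderiv_id z) (cderiv_cst (- z0) z)) _; rewrite addr0.
have := cderivM H1 IH; under eq_fun do rewrite -exprS.
move=> H; apply: cderiv_eq H _.
by case: j {IH} => [|j] /=; rewrite -?natr1 ?exprS; ring.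
Qed.

(** One differentiation replaces [K] by (j + 1) K + (z - z0) K', whose value at [z0] is (j + 1)
    K(z0); iteration accumulates the factorial. *)
Lemma derive1n_expM j (K : R[i] -> R[i]) z0 : smooth j K ->
  derive1n j (fun z => (z - z0) ^+ j * K z) z0 = j`!%:R * K z0.
Proof.
elim: j K => [|j IH] K; first by rewrite /derive1n /= !mul1r.
move=> [K' [HK HK']].
have nK : smooth j K by apply: smoothW; exists K'.
rewrite /derive1n iterSr -/(derive1n j _).
have -> : derive1 (fun z => (z - z0) ^+ j.+1 * K z) =
    (fun z => (z - z0) ^+ j * (j.+1%:R * K z + (z - z0) * K' z)).
  apply/funext => z; apply: cderiv_derive1.
  apply: cderiv_eq (cderivM (cderiv_expB j.+1 z0 z) (HK z)) _.
  by rewrite /= exprS; ring.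
rewrite IH; first by rewrite subrr mul0r addr0 factS natrM; ring.
apply: smoothD; apply: smoothM => //; first exact: smooth_cst.
apply: smoothD; [exact: smooth_id|exact: smooth_cst].
Qed.

(** When c z = 1, the factor 1 - c w equals - c (w - z); every other factor is nonzero at [z] and
    joins [K2]. *)
Lemma prod_factor_zero (gs : seq R[i]) (K : R[i] -> R[i]) z :
  (forall n, smooth n K) -> K z != 0 ->
  exists K2, [/\ forall n, smooth n K2, K2 z != 0 &
    forall w, (\prod_(c <- gs) (1 - c * w)) * K w =
      (w - z) ^+ count (fun c => c * z == 1) gs * K2 w].
Proof.
move=> nK Kz; elim: gs => [|c gs [K2 [n2 K2z E]]].
  by exists K; split => // w; rewrite big_nil expr0.
have nl : forall n (a b : R[i]), smooth n (fun w => a + b * w).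
  move=> n a b; apply: smoothD; first exact: smooth_cst.
  by apply: smoothM; [exact: smooth_cst|exact: smooth_id].
rewrite /=; have [cz|cz] := eqVneq (c * z) 1.
  exists (fun w => (- c) * K2 w); split.
  - by move=> n; apply: smoothM => //; exact: smooth_cst.
  - rewrite mulf_neq0// oppr_eq0; apply: contra_eq_neq cz => ->.
    by rewrite mul0r eq_sym oner_eq0.
  - move=> w; rewrite big_cons -mulrA E -cz add1n exprS; ring.
exists (fun w => (1 + (- c) * w) * K2 w); split.
- by move=> n; apply: smoothM.
- by rewrite mulf_neq0// mulNr subr_eq0 eq_sym.
- by move=> w; rewrite big_cons -mulrA E add0n; ring.
Qed.

Lemma leq_size_count_mem (T : eqType) (s t : seq T) :
  (forall x, (count_mem x s <= count_mem x t)%N) -> (size s <= size t)%N.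
Proof.
by move=> /(proj1 (count_subseqP _ _))[u ut /perm_size ->]; exact: size_subseq.
Qed.

(** If [z] occurred in [l] more often than among the reciprocals of [gs], the derivative whose order
    is the number of factors vanishing at [z] would be 0; but it is a factorial times a nonzero
    value. *)
Lemma at_most_nonreal_zeros_prod (gs : seq R[i]) (F K : R[i] -> R[i]) :
  (forall n, smooth n K) -> (forall z, complex.Im z != 0 -> K z != 0) ->
  (forall z, F z = (\prod_(c <- gs) (1 - c * z)) * K z) ->
  at_most_nonreal_zeros F (size gs).
Proof.
move=> nK Kz FE l Hl; rewrite -(size_map GRing.inv gs); apply: leq_size_count_mem => z.
have [zl|zl] := boolP (z \in l); last by rewrite (count_memPn zl).
have [Imz vz] := Hl z zl.
have [K2 [nK2 K2z E]] := prod_factor_zero gs nK (Kz _ Imz).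
have z0 : z != 0 by apply: contra_neq Imz => ->.
have -> : count_mem z [seq x^-1 | x <- gs] = count (fun c => c * z == 1) gs.
  rewrite count_map; apply: eq_count => c /=.
  (* A zero entry stands for a factor 1; its inverse is 0 by convention, which differs from the
     nonreal [z]. *)
  have [->|c0] := eqVneq c 0; first by rewrite invr0 mul0r eq_sym (negPf z0) eq_sym oner_eq0.
  by rewrite -(inj_eq (mulfI c0)) mulfV// eq_sym.
rewrite leqNgt; apply/negP => /vz.
have -> : F = (fun w => (w - z) ^+ count (fun c => c * z == 1) gs * K2 w).
  by apply/funext => w; rewrite FE E.
rewrite derive1n_expM//; apply/eqP; rewrite mulf_neq0//.
Qed.
End Multiplicity.

(** * Limits of polynomials with all but k zeros nonnegative *)

Section InfiniteProducts.
Variable R : realType.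
Implicit Types (x y t : R) (s : seq R) (w z : R[i]).

Definition lin_prod (cs : seq R[i]) : {poly R[i]} := \prod_(c <- cs) (1 - c%:P * 'X).

Lemma coef_linM (c : R[i]) (q : {poly R[i]}) m :
  ((1 - c%:P * 'X) * q)`_m = q`_m - c * (if m is m'.+1 then q`_m' else 0).
Proof.
by rewrite mulrBl mul1r -mulrA coefB coefCM coefXM; case: m.
Qed.

Lemma coef0_lin_prod cs : (lin_prod cs)`_0 = 1.
Proof.
elim: cs => [|c cs IH]; first by rewrite /lin_prod big_nil coef1.
by rewrite /lin_prod big_cons coef_linM IH mulr0 subr0.
Qed.

Lemma coef1_lin_prod cs : (lin_prod cs)`_1 = - \sum_(c <- cs) c.
Proof.
elim: cs => [|c cs IH]; first by rewrite /lin_prod !big_nil coef1 oppr0.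
by rewrite /lin_prod !big_cons coef_linM -!/(lin_prod _) coef0_lin_prod IH mulr1 opprD addrC.
Qed.

Lemma horner_lin_prod cs w : (lin_prod cs).[w] = \prod_(c <- cs) (1 - c * w).
Proof.
rewrite /lin_prod horner_prod; apply: eq_bigr => c _.
by rewrite !hornerE.
Qed.

Lemma exprD_ge_linear x y m : 0 <= x -> 0 <= y ->
  x ^+ m.+1 + m.+1%:R * (y * x ^+ m) <= (x + y) ^+ m.+1.
Proof.
move=> x0 y0; elim: m => [|m IH]; first by rewrite !expr1 expr0 mulr1 mul1r.
rewrite exprS [leRHS]exprS -[m.+2%:R]natr1.
have : (x + y) * (x ^+ m.+1 + m.+1%:R * (y * x ^+ m)) <= (x + y) * (x + y) ^+ m.+1.
  by rewrite ler_wpM2l// addr_ge0.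
apply: le_trans.
have : 0 <= m.+1%:R * (y ^+ 2 * x ^+ m) by rewrite !mulr_ge0// exprn_ge0.
rewrite -subr_ge0 => H; rewrite -subr_ge0.
apply: le_trans H _; rewrite le_eqVlt; apply/orP; left; apply/eqP.
rewrite [x ^+ m.+1]exprS; ring.
Qed.

(** Up to sign the coefficient is the m-th elementary symmetric polynomial of [s], which occurs m!
    times in the expanded m-th power of the sum. The induction needs two terms of the binomial
    expansion. *)
Lemma coef_lin_prod_le s m : all (fun x => 0 <= x) s ->
  cmod (lin_prod [seq x%:C | x <- s])`_m <= (\sum_(x <- s) x) ^+ m / m`!%:R.
Proof.
elim: s m => [|x s IH] m.
  move=> _; rewrite /lin_prod !big_nil coef1 expr0n; case: m => [|m] /=.
    by rewrite cmod1 fact0 divr1.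
  by rewrite cmod0 mul0r.
move=> /= /andP[x0 s0]; rewrite /lin_prod !big_cons coef_linM -/(lin_prod _).
set S := \sum_(_ <- _) _.
have S0 : 0 <= S by rewrite /S big_seq sumr_ge0// => y /(allP s0).
apply: le_trans (cmodB _ _) _; case: m => [|m].
  by rewrite mulr0 cmod0 addr0; apply: le_trans (IH _ s0) _; rewrite !expr0.
apply: le_trans (lerD (IH _ s0) (_ : _ <= x * (S ^+ m / m`!%:R))) _.
  by rewrite cmodM cmod_real ger0_norm// ler_wpM2l// IH.
rewrite ler_pdivlMr ?ltr0n ?fact_gt0// mulrDl divfK ?pnatr_eq0 -?lt0n ?fact_gt0//.
rewrite -/S [x + S]addrC.
have -> : x * (S ^+ m / m`!%:R) * (m.+1)`!%:R = m.+1%:R * (x * S ^+ m).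
  rewrite factS natrM; field.
  by rewrite pnatr_eq0 -lt0n fact_gt0.
exact: exprD_ge_linear.
Qed.

(* cmod (1 - t w) ^+ 2 * (1 + C t) - 1 is t times a quadratic polynomial in t,
   whose discriminant is at most 0 for the C chosen in the proof. *)
Lemma cmod_factor_ge w : ~ (complex.Im w = 0 /\ 0 <= complex.Re w) ->
  exists2 C : R, 0 <= C & forall t, 0 <= t -> 1 <= cmod (1 - t%:C * w) ^+ 2 * (1 + C * t).
Proof.
case: w => x y /= xy.
have E t : cmod (1 - t%:C * (x +i* y)) ^+ 2 = 1 - 2 * x * t + (x ^+ 2 + y ^+ 2) * t ^+ 2.
  by rewrite cmod_sqr /=; ring.
have [x0|x0] := lerP x 0.
  exists 0 => // t t0; rewrite E mul0r addr0 mulr1 -addrA lerDl.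
  have : 0 <= (x ^+ 2 + y ^+ 2) * t ^+ 2 by rewrite mulr_ge0// ?addr_ge0 ?sqr_ge0.
  nra.
have y0 : 0 < `|y|.
  rewrite normr_gt0; apply/eqP => y0; apply: xy; split => //; exact: ltW.
pose r := x ^+ 2 + `|y| ^+ 2.
have r0 : 0 < r by rewrite /r addr_gt0// exprn_gt0.
(* With [u] and [v], the negated discriminant becomes 16 y^2 (C (C - v) - u^2), which is nonnegative
   because both C and C - v exceed u. *)
pose u := r / (4 * `|y|).
have u0 : 0 < u by rewrite divr_gt0// mulr_gt0.
pose v := r * x / (2 * `|y| ^+ 2).
have v0 : 0 < v by rewrite divr_gt0// ?mulr_gt0// exprn_gt0.
pose C := x + v + u.
have C0 : 0 < C by rewrite /C !addr_gt0.
have D : 0 <= 16 * C ^+ 2 * `|y| ^+ 2 - 8 * C * r * x - r ^+ 2.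
  have -> : r ^+ 2 = 16 * u ^+ 2 * `|y| ^+ 2.
    by rewrite /u; field; rewrite lt0r_neq0.
  have -> : 8 * C * r * x = 16 * C * v * `|y| ^+ 2.
    by rewrite /v; field; rewrite lt0r_neq0.
  have -> : 16 * C ^+ 2 * `|y| ^+ 2 - 16 * C * v * `|y| ^+ 2 - 16 * u ^+ 2 * `|y| ^+ 2 =
     16 * `|y| ^+ 2 * (C * (C - v) - u ^+ 2) by ring.
  apply: mulr_ge0; first by rewrite mulr_ge0// exprn_ge0.
  rewrite /C; nra.
exists (2 * C); first lra.
move=> t t0; rewrite E -[y ^+ 2]real_normK ?num_real// -/r.
pose Q := 2 * C * r * t ^+ 2 + (r - 4 * x * C) * t + (2 * C - 2 * x).
have Q0 : 0 <= Q.
  have : 0 <= 8 * C * r * Q.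
    have -> : 8 * C * r * Q = (4 * C * r * t + (r - 4 * x * C)) ^+ 2 +
      (16 * C ^+ 2 * `|y| ^+ 2 - 8 * C * r * x - r ^+ 2).
      have yE : `|y| ^+ 2 = r - x ^+ 2 by rewrite /r; ring.
      by rewrite /Q yE; ring.
    by rewrite addr_ge0// sqr_ge0.
  by rewrite pmulr_rge0// !mulr_gt0.
have -> : (1 - 2 * x * t + r * t ^+ 2) * (1 + 2 * C * t) = 1 + t * Q by rewrite /Q; ring.
by rewrite lerDl mulr_ge0.
Qed.

(** By 1 + y <= exp y, the bounds on the factors multiply to a bound that depends on the sum of [s]
    and not on its length. *)
Lemma lin_prod_ge w (S : R) : ~ (complex.Im w = 0 /\ 0 <= complex.Re w) -> exists2 d : R, 0 < d &
  forall s, all (fun x => 0 <= x) s -> \sum_(x <- s) x <= S ->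
  d <= cmod (lin_prod [seq x%:C | x <- s]).[w].
Proof.
move=> /cmod_factor_ge[C C0 H].
have H2 s : all (fun x => 0 <= x) s ->
    1 <= cmod (lin_prod [seq x%:C | x <- s]).[w] ^+ 2 * expR (C * \sum_(x <- s) x).
  rewrite horner_lin_prod big_map; elim: s => [|x s IH] /=.
    by rewrite !big_nil cmod1 mulr0 expR0 expr1n mulr1.
  move=> /andP[x0 /IH {}IH]; rewrite !big_cons cmodM exprMn mulrDr expRD mulrACA.
  rewrite -[leLHS]mulr1; apply: ler_pM => //.
  apply: le_trans (H x x0) _; rewrite ler_wpM2l ?exprn_ge0 ?cmod_ge0//.
  exact: expR_ge1Dx.
exists (expR (- (C * `|S|))); first exact: expR_gt0.
move=> s s0 sS; have := H2 s s0; set c := cmod _.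
have c0 : 0 <= c by exact: cmod_ge0.
have : expR (C * \sum_(x <- s) x) <= expR (C * `|S|).
  by rewrite ler_expR ler_wpM2l// (le_trans sS)// ler_norm.
rewrite expRN; set e := expR (C * `|S|); set e' := expR _ => ee H3.
have e1 : 1 <= e by rewrite /e -expR0 ler_expR mulr_ge0.
rewrite -div1r ler_pdivrMr ?expR_gt0//.
have {H3} : 1 <= c ^+ 2 * e by apply: le_trans H3 _; rewrite ler_wpM2l// exprn_ge0.
rewrite expr2; nra.
Qed.

(** Multiplication by the factors 1 - b_i w, done on coefficient sequences because the limit of the
    polynomials is only a power series. Each entry is a finite expression, so it passes to the
    limit. *)
Fixpoint lin_mulseq (b : nat -> R[i]) k (a : nat -> R[i]) : nat -> R[i] :=
  if k is k'.+1 then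
    (fun m => lin_mulseq b k' a m + (- b k') * pshift (lin_mulseq b k' a) m)
  else a.

Lemma exp_type_lin_mulseq b k a : exp_type a -> exp_type (lin_mulseq b k a).
Proof.
move=> ha; elim: k => //= k IH; apply: exp_typeD => //.
apply: exp_typeM; exact: exp_type_pshift.
Qed.

Lemma psum_lin_mulseq b k a w : exp_type a ->
  psum (lin_mulseq b k a) w = (\prod_(i < k) (1 - b i * w)) * psum a w.
Proof.
move=> ha; elim: k => [|k IH] /=; first by rewrite big_ord0 mul1r.
have hk := exp_type_lin_mulseq b k ha; have hs := exp_type_pshift hk.
rewrite psumD//; last exact: exp_typeM.
rewrite psumM// psum_pshift// IH big_ord_recr /=; ring.
Qed.

Lemma coef_lin_mulseq (b : nat -> R[i]) k (q : {poly R[i]}) m :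
  ((\prod_(i < k) (1 - (b i)%:P * 'X)) * q)`_m = lin_mulseq b k (fun m => q`_m) m.
Proof.
elim: k m => [|k IH] m /=; first by rewrite big_ord0 mul1r.
rewrite big_ord_recr /= mulrAC mulrC coef_linM IH mulNr.
by case: m => [|m] //=; rewrite IH.
Qed.

Lemma psum_poly (q : {poly R[i]}) w : exp_type (fun m => q`_m) -> psum (fun m => q`_m) w = q.[w].
Proof.
move=> hq; apply: (clim_unique (psum_lim w hq)).
apply: (clim_near (clim_cst _)); near=> n.
rewrite big_mkord; apply: horner_coef_wide.
near: n; exact: nbhs_infty_ge.
Unshelve. all: by end_near. Qed.

Lemma clim_lin_mulseq (U : set_system nat) {UF : ProperFilter U} (b : nat -> nat -> R[i]) b'
    (a : nat -> nat -> R[i]) a' k m :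
  (forall i, (i < k)%N -> clim U (b^~ i) (b' i)) -> (forall i, clim U (a^~ i) (a' i)) ->
  clim U (fun N => lin_mulseq (b N) k (a N) m) (lin_mulseq b' k a' m).
Proof.
move=> + ha; elim: k m => [|k IH] m hb /=; first exact: ha.
have {}IH m' := IH m' (fun i ik => hb i (ltnW ik)).
apply: climD; first exact: IH.
apply: climM; last by case: m => [|m] /=; [exact: clim_cst|exact: IH].
under eq_fun do rewrite -[- b _ _]sub0r.
by rewrite -[- b' k]sub0r; apply: climB; [exact: clim_cst|exact: hb].
Qed.

(** A cluster point of an ultrafilter is a limit. One ultrafilter makes all bounded sequences
    converge at once, in place of diagonal subsequences. *)
Lemma ultra_cvg (U : set_system nat) {UU : UltraFilter U} (u : nat -> R) (C : R) :
  (\forall n \near U, `|u n| <= C) -> exists l : R, u @ U --> l.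
Proof.
move=> H.
have [|l [_ lU]] := @segment_compact R (- C) C (u @ U) _.
  by apply: filterS H => n /=; rewrite in_itv /= ler_norml.
exists l => A nA.
have [//|UA] := in_ultra_setVsetC (u @^-1` A) UU.
have [x [/= nAx Ax]] := lU (~` A) A UA nA.
by case: (nAx Ax).
Qed.

Lemma ultra_clim (U : set_system nat) {UU : UltraFilter U} (u : nat -> R[i]) (C : R) :
  (\forall n \near U, cmod (u n) <= C) -> exists l, clim U u l.
Proof.
move=> H.
have [x hx] : exists l : R, (fun n => complex.Re (u n)) @ U --> l.
  by apply: (@ultra_cvg _ _ _ C); apply: filterS H => n; apply: le_trans; exact: Re_le_cmod.
have [y hy] : exists l : R, (fun n => complex.Im (u n)) @ U --> l.
  by apply: (@ultra_cvg _ _ _ C); apply: filterS H => n; apply: le_trans; exact: Im_le_cmod.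
by exists (x +i* y); split.
Qed.

(** The common bound [S] makes the tails small uniformly in [N], which leaves finitely many
    coefficients. *)
Lemma clim_psum (U : set_system nat) {UF : ProperFilter U} (a : nat -> nat -> R[i]) a' (S : R) w :
  0 <= S -> (\forall N \near U, exp_bounded (a N) 1 S) -> exp_bounded a' 1 S ->
  (forall m, clim U (a^~ m) (a' m)) -> clim U (fun N => psum (a N) w) (psum a' w).
Proof.
move=> S0 ha ha' L; apply: clim_eps => e e0.
have e4 : 0 < e / 4 by rewrite divr_gt0.
have : \forall n \near \oo, exp_tail (S * cmod w) n <= e / 4.
  have := @exp_tail_cvg R (S * cmod w) => /cvgr_le; apply.
  by rewrite divr_gt0.
move=> [n _ /(_ n (leqnn n)) /= Hn].
have : clim U (fun N => \sum_(0 <= m < n) a N m * w ^+ m) (\sum_(0 <= m < n) a' m * w ^+ m).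
  apply: (@clim_sum _ _ _ _ _ _ (fun m N => a N m * w ^+ m)) => m.
  by apply: climM => //; exact: clim_cst.
move=> /clim_epsP - /(_ _ e4) HN.
apply: filterS2 ha HN => N haN HN.
have := psum_tail w n haN S0; have := psum_tail w n ha' S0; rewrite mul1r => H1 H2.
set A := psum (a N) w in H2 *; set B := psum a' w in H1 *.
set A' := \sum_(0 <= m < n) a N m * w ^+ m in H2 HN; set B' := \sum_(0 <= m < n) a' m * w ^+ m in H1 HN.
have -> : A - B = (A - A') + (A' - B') - (B - B') by ring.
apply: le_trans (cmodB _ _) _.
have := cmodD (A - A') (A' - B'); lra.
Qed.
End InfiniteProducts.

(** * Passage to the limit with explicit factors *)

Section Hurwitz.
Variable R : realType.
Implicit Types (w : R[i]).

Lemma geometric_sum_le (x : R) n : 0 <= x <= 1 / 2 -> \sum_(0 <= m < n) x ^+ m <= 2.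
Proof.
move=> /andP[x0 x2]; elim: n => [|n IH]; first by rewrite big_geq.
rewrite big_nat_recl// expr0.
under eq_bigr do rewrite exprS.
rewrite -mulr_sumr; nra.
Qed.

(** At a root the constant term is balanced by the others, whose sum is at most 2 K x with x = B |w|
    <= 1/2; this is less than [d] when x < d / (4 K + 4). The summand 4 keeps the denominator
    positive when [K] is 0. *)
Lemma root_bound (p : {poly R[i]}) (K B d : R) w : 0 <= K -> 0 < B -> 0 < d ->
  d <= cmod p`_0 -> (forall m, cmod p`_m <= K * B ^+ m) -> root p w ->
  Num.min (1 / 2) (d / (4 * K + 4)) / B <= cmod w.
Proof.
move=> K0 B0 d0 dp pK /rootP pw; rewrite leNgt; apply/negP.
rewrite ltr_pdivlMr// mulrC lt_min => /andP[x2].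
have K4 : 0 < 4 * K + 4 by lra.
rewrite ltr_pdivlMr// => xd; set x := B * cmod w in x2 xd.
have x0 : 0 <= x by rewrite mulr_ge0 ?cmod_ge0// ltW.
have : cmod p`_0 <= 2 * K * x.
  have := horner_coef_wide w (leqnSn (size p)).
  rewrite pw -(big_mkord xpredT (fun m => p`_m * w ^+ m)) big_nat_recl// expr0 mulr1.
  move=> /esym/eqP; rewrite addr_eq0 => /eqP ->; rewrite cmodN.
  apply: le_trans (cmod_sum _ _ _) _.
  apply: (@le_trans _ _ (\sum_(0 <= m < size p) K * x * x ^+ m)).
    apply: ler_sum => m _; rewrite cmodM cmodX -mulrA -exprS exprMn mulrA.
    by rewrite ler_wpM2r ?exprn_ge0 ?cmod_ge0.
  rewrite -mulr_sumr (_ : 2 * K * x = K * x * 2); last by ring.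
  rewrite ler_wpM2l//; first exact: mulr_ge0.
  by apply: geometric_sum_le; rewrite x0 ltW.
nra.
Qed.

(* The inverses b of the k exceptional zeros are bounded, so along an
   ultrafilter they converge to b'; the inverses of the zeros in [0, +oo[ have
   bounded sums, so the products over them converge to an entire function. *)
Lemma hurwitz_limit k (p : nat -> {poly R[i]}) (c : nat -> R[i]) (b : nat -> nat -> R[i])
    (s : nat -> seq R) (a : nat -> R[i]) (K B : R) : 0 <= K -> 0 < B ->
  (forall N, p N = c N *: ((\prod_(i < k) (1 - (b N i)%:P * 'X)) *
                            lin_prod [seq x%:C | x <- s N])) ->
  (forall N, all (fun x => 0 <= x) (s N)) ->
  (\forall N \near \oo, forall m, cmod (p N)`_m <= K * B ^+ m) ->
  (forall m, clim \oo (fun N => (p N)`_m) (a m)) -> a 0%N != 0 ->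
  exists b' g, [/\ exp_type g,
    forall w, ~ (complex.Im w = 0 /\ 0 <= complex.Re w) -> psum g w != 0 &
    forall m, a m = a 0%N * lin_mulseq b' k g m].
Proof.
move=> K0 B0 pE s0 pK pa a0.
pose d := cmod (a 0%N) / 2.
have d0 : 0 < d by rewrite divr_gt0// cmod_gt0.
have lp0 N i : ((\prod_(i < i) (1 - (b N i)%:P * 'X)) * lin_prod [seq x%:C | x <- s N])`_0 = 1.
  by rewrite coef_lin_mulseq; elim: i => [|i IH] /=; rewrite ?coef0_lin_prod// IH mulr0 addr0.
have p0 N : (p N)`_0 = c N by rewrite pE coefZ lp0 mulr1.
have cd : \forall N \near \oo, d <= cmod (c N).
  apply: filterS (clim_epsP (pa 0%N) d0) => N; rewrite p0 cmodC => H.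
  have : cmod (a 0%N) = 2 * d by rewrite /d; field.
  have := cmodD (a 0%N - c N) (c N); rewrite subrK; lra.
pose rho := Num.min (1 / 2) (d / (4 * K + 4)) / B.
have rho0 : 0 < rho.
  rewrite divr_gt0// lt_min divr_gt0//=; rewrite divr_gt0//; lra.
have bB : \forall N \near \oo, forall i, (i < k)%N -> cmod (b N i) <= rho^-1.
  near=> N => i ik.
  have [->|b0] := eqVneq (b N i) 0; first by rewrite cmod0 invr_ge0 ltW.
  rewrite -[b N i]invrK cmodV lef_pV2 ?posrE ?cmod_gt0 ?invr_eq0//.
  apply: (@root_bound (p N) K B d) => //.
  - by rewrite p0; near: N.
  - by near: N.
  rewrite pE rootE hornerZ hornerM horner_prod (bigD1 (Ordinal ik)) //= !hornerE.
  by rewrite /= mulfV// subrr mulr0 !mul0r.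
(* The coefficient of degree 1 is [- c N] times the sum of all reciprocals. It is at most [K * B] in
   modulus, [d <= cmod (c N)], and each of the [k] exceptional reciprocals is at most [rho^-1]. *)
pose S := K * B / d + k%:R * rho^-1.
have S0 : 0 <= S.
  by rewrite addr_ge0// mulr_ge0 ?invr_ge0//; [exact: mulr_ge0 (ltW _)|exact: ltW|exact: ltW].
have sS : \forall N \near \oo, \sum_(x <- s N) x <= S.
  near=> N.
  have c1 : d <= cmod (c N) by near: N.
  have c0 : c N != 0 by rewrite -cmod_gt0; exact: lt_le_trans c1.
  have : cmod (p N)`_1 <= K * B by rewrite -[B]expr1; near: N; apply: filterS pK => N.
  have -> : (p N)`_1 = - c N * (\sum_(i < k) b N i + \sum_(x <- s N) x%:C).
    rewrite pE coefZ mulNr -mulrN; congr (_ * _).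
    have -> : \prod_(i < k) (1 - (b N i)%:P * 'X) = lin_prod [seq b N (val i) | i <- index_enum 'I_k].
      by rewrite /lin_prod big_map.
    rewrite /lin_prod -big_cat -/(lin_prod _) coef1_lin_prod big_cat !big_map/=.
    by [].
  rewrite cmodM cmodN => H.
  have Ss : \sum_(x <- s N) x = cmod (\sum_(x <- s N) x%:C).
    by rewrite -rmorph_sum cmod_real ger0_norm// big_seq sumr_ge0// => x /(allP (s0 N)).
  rewrite Ss.
  have -> : \sum_(x <- s N) x%:C =
     (\sum_(i < k) b N i + \sum_(x <- s N) x%:C) - \sum_(i < k) b N i by ring.
  apply: le_trans (cmodB _ _) _; apply: lerD.
    rewrite ler_pdivlMr// mulrC; apply: le_trans H.
    by rewrite ler_wpM2r ?cmod_ge0.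
  apply: le_trans (cmod_sum _ _ _) _.
  have bN : forall i, (i < k)%N -> cmod (b N i) <= rho^-1 by near: N.
  apply: (@le_trans _ _ (\sum_(i < k) rho^-1)).
    by apply: ler_sum => i _; exact: bN (ltn_ord i).
  by rewrite sumr_const card_ord mulr_natl.
(* The ultrafilter refines [\oo], so the known limits [a m] persist along it and can be identified
   with those of the factored form. *)
have [U [UU oU]] := ultraFilterLemma eventually_filter.
have climU (u : nat -> R[i]) (l : R[i]) : clim \oo u l -> clim U u l.
  by move=> [u1 u2]; split; [apply: cvg_trans u1|apply: cvg_trans u2] => A; exact: oU.
pose g N m := (lin_prod [seq x%:C | x <- s N])`_m.
have gS : \forall N \near U, exp_bounded (g N) 1 S.
  apply: oU; apply: filterS sS => N sNS m; rewrite mul1r.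
  apply: le_trans (coef_lin_prod_le m (s0 N)) _; rewrite ler_wpM2r//.
  by apply: lerXn2r => //; rewrite nnegrE big_seq sumr_ge0// => x /(allP (s0 N)).
have /choice[b' hb'] i : exists l, (i < k)%N -> clim U (b^~ i) l.
  case: (ltnP i k) => [ik|]; last by exists 0.
  have [|l hl] := @ultra_clim R U UU (b^~ i) rho^-1; last by exists l.
  by apply: oU; apply: filterS bB => N; apply.
have /choice[g' hg'] m : exists l, clim U (g^~ m) l.
  apply: (@ultra_clim R U UU (g^~ m) (S ^+ m / m`!%:R)).
  by apply: filterS gS => N /(_ m); rewrite mul1r.
have g'S : exp_bounded g' 1 S.
  by move=> m; apply: (clim_le (hg' m)); apply: filterS gS => N.
exists b', g'; split.
- by exists 1, S; split.
- move=> w /(lin_prod_ge S)[e e0 He].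
  rewrite -cmod_gt0; apply: lt_le_trans e0 _.
  apply: (clim_ge (clim_psum w S0 gS g'S hg')).
  apply: filterS2 (oU _ sS) gS => N sNS gN; rewrite psum_poly; first exact: He.
  by exists 1, S; split.
- move=> m; apply: (clim_unique (climU _ _ (pa m))).
  apply: (clim_near (climM (climU _ _ (pa 0%N)) (clim_lin_mulseq m hb' hg'))).
  apply: filterE => N; rewrite p0 [in RHS]pE coefZ coef_lin_mulseq.
  by [].
Unshelve. all: by end_near. Qed.
End Hurwitz.

(** * From zeros to reciprocal linear factors *)

Section LinearFactors.
Variable R : realType.
Implicit Types (f q : {poly R}) (cs : seq R[i]).

Lemma lin_prod_pad cs k : (size cs <= k)%N ->
  lin_prod cs = \prod_(i < k) (1 - (nth 0 cs i)%:P * 'X).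
Proof.
elim: cs k => [|c cs IH] [|k] //= sk.
- by rewrite /lin_prod big_nil big_ord0.
- by rewrite /lin_prod big_nil big1// => i _; rewrite nth_nil mul0r subr0.
- by rewrite /lin_prod big_cons big_ord_recl /= -IH.
Qed.

Lemma coef_lin_prod_scale (l : R[i]) cs m :
  (lin_prod [seq l * c | c <- cs])`_m = l ^+ m * (lin_prod cs)`_m.
Proof.
elim: cs m => [|c cs IH] m.
  by rewrite /lin_prod !big_nil coef1; case: m => [|m]; rewrite ?mulr1 ?mulr0.
rewrite /lin_prod !big_cons !coef_linM -!/(lin_prod _) IH.
by case: m => [|m]; rewrite ?IH ?exprS; ring.
Qed.

Lemma prod_XsubC_lin_prod cs : exists c : R[i],
  \prod_(z <- cs) ('X - z%:P) =
  c *: ('X^(count_mem 0 cs) * lin_prod [seq z^-1 | z <- cs & z != 0]).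
Proof.
elim: cs => [|z cs [c IH]].
  by exists 1; rewrite /lin_prod !big_nil mulr1 scale1r.
rewrite big_cons {}IH /=; have [->|z0] := eqVneq z 0; rewrite /=.
  by exists c; rewrite subr0 -scalerAr exprS mulrA.
exists (- z * c); rewrite /lin_prod big_cons add0n.
have -> : 'X - z%:P = (- z) *: (1 - (z^-1)%:P * 'X).
  have zz : z%:P * (z^-1)%:P = 1 by rewrite -polyCM mulfV.
  rewrite -mul_polyC polyCN mulrBr mulrA mulNr mulNr zz; ring.
rewrite -!mul_polyC polyCM; ring.
Qed.

(** The cofactor [q] splits over [R[i]]. Its zero roots account for the whole order [r] of [f] at 0,
    since the roots in [s] are positive; rescaling the variable by [l] multiplies each reciprocal by
    [l]. *)
Lemma linear_factors_form k f q (s : seq R) r (l : R) : 0 <= l ->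
  f = q * \prod_(a <- s) ('X - a%:P) -> all (fun a => 0 < a) s -> (size q <= k.+1)%N ->
  f`_r != 0 -> (forall m, (m < r)%N -> f`_m = 0) ->
  exists (c : R[i]) (b : nat -> R[i]) (t : seq R), all (fun x => 0 <= x) t /\ forall m,
    (c *: ((\prod_(i < k) (1 - (b i)%:P * 'X)) * lin_prod [seq x%:C | x <- t]))`_m =
    (f`_(m + r) * l ^+ m)%:C.
Proof.
move=> l0 fE s0 qk fr f0.
pose toC := real_complex R : {rmorphism R -> R[i]}.
have q0 : q != 0 by apply: contra_neq fr => q0; rewrite fE q0 mul0r coef0.
have [rs qE] := closed_field_poly_normal (map_poly toC q).
have lq : lead_coef (map_poly toC q) != 0 by rewrite lead_coef_eq0 map_poly_eq0.
have rsk : (size rs <= k)%N.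
  move: qk; rewrite -(size_map_poly toC q) qE size_scale// size_prod_XsubC ltnS.
  by [].
have [c1 H1] := prod_XsubC_lin_prod rs.
have [c2 H2] := prod_XsubC_lin_prod [seq toC a | a <- s].
have s0' : all (fun z => z != 0) [seq toC a | a <- s].
  rewrite all_map; apply/allP => a /(allP s0) a0 /=.
  by rewrite fmorph_eq0 gt_eqF.
have c20 : count_mem 0 [seq toC a | a <- s] = 0%N.
  apply/count_memPn/negP => /(allP s0'); by rewrite eqxx.
rewrite c20 (all_filterP s0') expr0 mul1r in H2.
set rs' := [seq z^-1 | z <- rs & z != 0] in H1.
set j := count_mem 0 rs in H1.
set t' := [seq z^-1 | z <- _] in H2.
pose c := lead_coef (map_poly toC q) * c1 * c2.
have fC : map_poly toC f = c *: ('X^j * (lin_prod rs' * lin_prod t')).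
  rewrite fE rmorphM /= qE rmorph_prod.
  under [X in _ * X]eq_bigr do rewrite /= map_polyXsubC.
  rewrite -(big_map toC predT (fun z => 'X - z%:P)) H1 H2.
  by rewrite -!mul_polyC /c !polyCM; ring.
have lp0 : (lin_prod rs' * lin_prod t')`_0 = 1.
  by rewrite coef0M !coef0_lin_prod mulr1.
have c0 : c != 0.
  apply: contra_neq fr => c0; apply: (fmorph_inj toC).
  by rewrite -coef_map fC c0 scale0r coef0 rmorph0.
have jr : j = r.
  apply/eqP; rewrite eqn_leq; apply/andP; split; rewrite leqNgt; apply/negP => lt.
    move/eqP: fr; apply; apply: (fmorph_inj toC).
    by rewrite -coef_map fC coefZ coefXnM lt mulr0 rmorph0.
  have := f0 j lt; move/(congr1 toC); rewrite -coef_map fC coefZ coefXnM ltnn subnn lp0 mulr1 rmorph0.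
  exact/eqP.
exists c, (nth 0 [seq toC l * z | z <- rs']), [seq l * x^-1 | x <- s]; split.
  rewrite all_map; apply/allP => a /(allP s0) /= a0.
  by rewrite mulr_ge0// invr_ge0 ltW.
move=> m; rewrite -lin_prod_pad; last first.
  by rewrite size_map size_map size_filter (leq_trans (count_size _ _)).
have -> : [seq x%:C | x <- [seq l / x | x <- s]] = [seq toC l * z | z <- t'].
  by rewrite /t' -!map_comp; apply: eq_map => x /=; rewrite rmorphM fmorphV.
rewrite /lin_prod -big_cat -map_cat -/(lin_prod _) coefZ coef_lin_prod_scale.
rewrite -[RHS]/(toC _) rmorphM rmorphXn -coef_map fC coefZ coefXnM jr.
rewrite ltnNge leq_addl /= addnK.
rewrite /lin_prod big_cat /= -!/(lin_prod _); ring.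
Qed.
End LinearFactors.

(** * Nonreal zeros of the Bessel series *)

Section CoefficientLimits.
Variable R : realType.
Implicit Types (x nu : R).

Lemma cvg_eq_near (u v : nat -> R) (l : R) : u @ \oo --> l ->
  (\forall N \near \oo, u N = v N) -> v @ \oo --> l.
Proof. by move=> ul uv; apply: cvg_trans ul; exact: near_eq_cvg. Qed.

Lemma binomial_ratio_le (T m : nat) : (0 < T)%N -> 'C(T, m)%:R * (T%:R ^- m) <= 1 :> R.
Proof.
move=> T0; rewrite ler_pdivrMr ?exprn_gt0 ?ltr0n// mul1r -natrX ler_nat.
elim: m => [|m IH]; first by rewrite bin0.
rewrite -(leq_pmul2l (ltn0Sn m)) mul_bin_left expnS mulnA.
apply: leq_mul => //; apply: (leq_trans (leq_subr _ _)); exact: leq_pmull.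
Qed.

Lemma binomial_ratio_cvg n m :
  (fun N : nat => 'C(n + N.+1, m)%:R * ((n + N.+1)%:R ^- m) : R) @ \oo --> ((m`!%:R)^-1 : R).
Proof.
have T0 N : (n + N.+1)%:R != 0 :> R by rewrite pnatr_eq0 addnS.
have TV : (fun N : nat => (n + N.+1)%:R^-1 : R) @ \oo --> (0 : R).
  have := @cvg_harmonic R; rewrite -(cvg_shiftn n).
  by apply: cvg_trans; apply: near_eq_cvg; near=> N; rewrite /harmonic /= addnS addnC.
elim: m => [|m IH].
  apply: (cvg_eq_near (cvg_cst _)); near=> N.
  by rewrite fact0 bin0 expr0 invr1 mulr1.
have : (fun N : nat => 'C(n + N.+1, m)%:R * ((n + N.+1)%:R ^- m) *
    ((1 - m%:R * (n + N.+1)%:R^-1) / m.+1%:R) : R) @ \oo -->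
    ((m`!%:R)^-1 * ((1 - m%:R * 0) / m.+1%:R) : R).
  apply: cvgM => //; apply: cvgM; last exact: cvg_cst.
  by apply: cvgB; [exact: cvg_cst|apply: cvgM => //; exact: cvg_cst].
rewrite mulr0 subr0 mul1r factS natrM invfM mulrC.
move=> /cvg_eq_near; apply; near=> N.
have mN : (m <= n + N.+1)%N.
  by rewrite (leq_trans _ (leq_addl _ _))// ltnW// ltnS; near: N; exact: nbhs_infty_ge.
have := mul_bin_left (n + N.+1) m => /(congr1 (fun k => k%:R : R)).
rewrite !natrM natrB// => H.
have -> : 'C(n + N.+1, m.+1)%:R = ((n + N.+1)%:R - m%:R) * 'C(n + N.+1, m)%:R / m.+1%:R :> R.
  by rewrite -H mulrAC mulfV ?mul1r// pnatr_eq0.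
rewrite exprS; have := T0 N; set T := (n + N.+1)%:R => TN0.
have Tm : T ^+ m != 0 by rewrite expf_neq0.
have m1 : m.+1%:R != 0 :> R by rewrite pnatr_eq0.
clearbody T; move: m.+1%:R m1 => t t0.
by field; rewrite TN0 Tm.
Unshelve. all: by end_near. Qed.

(** [gam] stands for 1 / Gamma, whose recurrence in this form also holds at the poles of Gamma. *)
Variables (gam : R -> R) (nu : R).
Hypothesis gamS : forall x, gam x = x * gam (x + 1).
Hypothesis gam_gt0 : forall x, 0 < x -> 0 < gam x.

(** Unrolled up to a positive argument, the recurrence writes [gam x] as a product of factors x + i
    and a positive number. *)
Lemma gam_eq0 x : gam x = 0 -> exists j : nat, x + j%:R = 0.
Proof.
have gamn (j : nat) : gam x = \prod_(i < j) (x + i%:R) * gam (x + j%:R).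
  elim: j => [|j IH]; first by rewrite big_ord0 mul1r addr0.
  by rewrite big_ord_recr /= IH gamS -mulrA -natr1 addrA.
move=> g0; have [j xj] : exists j : nat, 0 < x + j%:R.
  exists (Num.truncn (- x)).+1; have := truncnS_gt (- x); lra.
have := gamn j; rewrite g0 => /esym/eqP; rewrite mulf_eq0 => /orP[|]; last first.
  by rewrite gt_eqF// gam_gt0.
by move=> /prodf_eq0[i _ /eqP H]; exists (val i).
Qed.

Section GaussQuotient.
Variable m0 : nat.
Hypothesis m0P : 0 < nu + m0%:R + 1.

Let kappa N := \prod_(j < N.+1) (m0%:R + nu + 1 + j%:R) / (N.+1%:R ^+ m0 * gam (nu + m0%:R + 1)).

(* Gauss's formula: the quotient tends to gam (nu + m + 1), and kappa makes it
   equal to this limit at m = m0. *)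
Definition gauss_quotient N (m : nat) : R :=
  \prod_(j < N.+1) (m%:R + nu + 1 + j%:R) / (kappa N * N.+1%:R ^+ m).

Lemma gauss_quotient0 N : gauss_quotient N m0 = gam (nu + m0%:R + 1).
Proof.
have p0 : \prod_(j < N.+1) (m0%:R + nu + 1 + j%:R) != 0.
  apply/prodf_neq0 => j _; rewrite gt_eqF// ltr_wpDr//.
  by rewrite [m0%:R + nu]addrC.
have N0 : N.+1%:R ^+ m0 != 0 :> R by rewrite expf_neq0// pnatr_eq0.
have g0 : gam (nu + m0%:R + 1) != 0 by rewrite gt_eqF// gam_gt0.
by rewrite /gauss_quotient /kappa; field; rewrite p0 N0 g0.
Qed.

Lemma kappa_gt0 N : 0 < kappa N.
Proof.
rewrite divr_gt0//; last by rewrite mulr_gt0 ?exprn_gt0 ?gam_gt0.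
by apply: prodr_gt0 => j _; rewrite ltr_wpDr// [m0%:R + nu]addrC.
Qed.

(** The two products share all but their end factors. The values [gam (nu + m + 1)] obey the same
    relation without the term in [N.+1%:R^-1]. *)
Lemma gauss_quotientS N m : gauss_quotient N m.+1 * (nu + m%:R + 1) =
  gauss_quotient N m * (1 + (nu + m%:R + 1) * N.+1%:R^-1).
Proof.
have N0 : N.+1%:R != 0 :> R by rewrite pnatr_eq0.
have k0 : kappa N != 0 by rewrite gt_eqF// kappa_gt0.
have H : \prod_(j < N.+1) (m.+1%:R + nu + 1 + j%:R) * (nu + m%:R + 1) =
         \prod_(j < N.+1) (m%:R + nu + 1 + j%:R) * (m%:R + nu + 1 + N.+1%:R) :> R.
  transitivity (\prod_(j < N.+2) (m%:R + nu + 1 + j%:R)); last by rewrite big_ord_recr.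
  rewrite [RHS]big_ord_recl /= mulrC.
  congr (_ * _); first by rewrite addr0 [nu + _]addrC.
  apply: eq_bigr => j _; rewrite /bump /= add1n -!natr1; ring.
rewrite /gauss_quotient exprS.
have Nm : N.+1%:R ^+ m != 0 :> R by rewrite expf_neq0.
transitivity (\prod_(j < N.+1) (m.+1%:R + nu + 1 + j%:R) * (nu + m%:R + 1) /
  (kappa N * (N.+1%:R * N.+1%:R ^+ m))); first by rewrite mulrAC.
rewrite H; move: N.+1%:R N0 (N.+1%:R ^+ m) Nm => t t0 u u0.
by field; rewrite t0 u0 k0.
Qed.

Lemma gauss_quotient_cvg m : gauss_quotient ^~ m @ \oo --> gam (nu + m%:R + 1).
Proof.
have H1 (t : R) : (fun N : nat => 1 + t * N.+1%:R^-1) @ \oo --> (1 : R).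
  have E : 1 + t * 0 = 1 by rewrite mulr0 addr0.
  rewrite -[X in _ --> X]E.
  by apply: cvgD; [exact: cvg_cst|apply: cvgM; [exact: cvg_cst|exact: cvg_harmonic]].
have gS (j : nat) : gam (nu + j%:R + 1) = (nu + j%:R + 1) * gam (nu + j.+1%:R + 1).
  by rewrite gamS -natr1; congr (_ * gam _); ring.
case: (leqP m0 m) => [/subnKC <-|/ltnW /subnKC].
  elim: (m - m0)%N => [|i IH].
    rewrite addn0; apply: (cvg_eq_near (cvg_cst _)); near=> N.
    by rewrite gauss_quotient0.
  rewrite addnS; set j := (m0 + i)%N in IH *.
  have j0 : 0 < nu + j%:R + 1.
    by apply: lt_le_trans m0P _; rewrite lerD2r lerD2l ler_nat leq_addr.
  have j0' : nu + j%:R + 1 != 0 by rewrite gt_eqF.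
  have -> : gam (nu + j.+1%:R + 1) = gam (nu + j%:R + 1) * 1 / (nu + j%:R + 1).
    by rewrite (gS j) mulr1 mulrAC mulfV// mul1r.
  have : (fun N => gauss_quotient N j * (1 + (nu + j%:R + 1) * N.+1%:R^-1) / (nu + j%:R + 1)) @ \oo
     --> gam (nu + j%:R + 1) * 1 / (nu + j%:R + 1).
    by apply: cvgM; [exact: cvgM|exact: cvg_cst].
  move=> /cvg_eq_near; apply; near=> N.
  by rewrite -gauss_quotientS mulfK.
(* Below [m0] the recurrence is run downwards: it divides by a quantity tending to 1, whereas
   [nu + m + 1] may vanish there. *)
move: (m0 - m)%N => d; elim: d m => [|i IH] m.
  rewrite addn0 => ->; apply: (cvg_eq_near (cvg_cst _)); near=> N.
  by rewrite gauss_quotient0.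
rewrite -addSnnS => /IH {}IH; rewrite gS.
have : (fun N => (nu + m%:R + 1) * gauss_quotient N m.+1 / (1 + (nu + m%:R + 1) * N.+1%:R^-1)) @ \oo
     --> (nu + m%:R + 1) * gam (nu + m.+1%:R + 1) / 1.
  apply: cvgM; first by apply: cvgM => //; exact: cvg_cst.
  by apply: cvgV => //; rewrite oner_eq0.
rewrite divr1; move=> /cvg_eq_near; apply; near=> N.
rewrite mulrC [_ * gauss_quotient _ _]mulrC gauss_quotientS mulrC mulfK// gt_eqF//.
near: N.
by have /cvgr_gt := H1 (nu + m%:R + 1); apply; exact: ltr01.
Unshelve. all: by end_near. Qed.

(** From [m0] on, the ratio of consecutive quotients is [(nu + j + 1)^-1 + N.+1%:R^-1], at most [B];
    the finitely many earlier quotients are eventually within 1 of their limits. *)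
Lemma gauss_quotient_bound : exists K B : R, [/\ 0 <= K, 1 <= B &
  \forall N \near \oo, forall m, `|gauss_quotient N m| <= K * B ^+ m].
Proof.
pose B := 1 + (nu + m0%:R + 1)^-1.
have B1 : 1 <= B by rewrite lerDl invr_ge0 ltW.
pose K := gam (nu + m0%:R + 1) + \sum_(m < m0) (`|gam (nu + m%:R + 1)| + 1).
have K1 : 0 <= \sum_(m < m0) (`|gam (nu + m%:R + 1)| + 1).
  by rewrite sumr_ge0// => i _; rewrite addr_ge0.
have g0 := gam_gt0 m0P.
exists K, B; split => //; first by rewrite addr_ge0// ltW.
have : \forall N \near \oo, forall m : 'I_m0, `|gauss_quotient N m| <= `|gam (nu + m%:R + 1)| + 1.
  apply: filter_forall => m.
  have /cvgrPdist_le/(_ 1 ltr01) := @gauss_quotient_cvg (val m).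
  apply: filterS => N; rewrite /= => H.
  rewrite -[gauss_quotient N m](subrK (gam (nu + m%:R + 1))) addrC.
  apply: le_trans (ler_normD _ _) _; by rewrite lerD2l distrC.
apply: filterS => N HN m; case: (ltnP m m0) => [mm0|].
  apply: le_trans (HN (Ordinal mm0)) _ => /=.
  apply: (@le_trans _ _ K); last by rewrite ler_peMr ?exprn_ege1// addr_ge0// ltW.
  rewrite /K (bigD1 (Ordinal mm0)) //= addrCA lerDl addr_ge0//; first exact: ltW.
  by rewrite sumr_ge0// => i _; rewrite addr_ge0.
move=> /subnKC <-; apply: (@le_trans _ _ (K * B ^+ (m - m0))); last first.
  by rewrite ler_wpM2l ?addr_ge0 ?(ltW g0)// ler_weXn2l// leq_addl.
elim: (m - m0)%N => [|i IH].
  by rewrite addn0 gauss_quotient0 expr0 mulr1 gtr0_norm// lerDl.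
rewrite addnS; set j := (m0 + i)%N in IH *.
have j0 : 0 < nu + j%:R + 1.
  by apply: lt_le_trans m0P _; rewrite lerD2r lerD2l ler_nat leq_addr.
have -> : gauss_quotient N j.+1 = gauss_quotient N j * ((nu + j%:R + 1)^-1 + N.+1%:R^-1).
  have j0' : nu + j%:R + 1 != 0 by rewrite gt_eqF.
  have N0 : N.+1%:R != 0 :> R by rewrite pnatr_eq0.
  apply: (mulIf j0'); rewrite gauss_quotientS.
  by move: (N.+1%:R : R) N0 (nu + _ + 1) j0' => u u0 t t0; field; rewrite t0 u0.
rewrite normrM exprSr mulrA; apply: ler_pM => //.
rewrite ger0_norm; last by rewrite addr_ge0// invr_ge0 ltW.
rewrite /B addrC lerD//; first by rewrite invf_le1// ler1n.
rewrite lef_pV2 ?posrE// lerD2r lerD2l ler_nat leq_addr//.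
Qed.
End GaussQuotient.
End CoefficientLimits.

(** * Factorization of the Bessel series and its nonreal zeros *)

Section NonrealZeros.
Variable R : realType.
Variables (gam : R -> R) (nu : R).
Hypothesis gamS : forall x, gam x = x * gam (x + 1).
Hypothesis gam_gt0 : forall x, 0 < x -> 0 < gam x.
Variable n : nat.

(* The coefficients, in powers of w = z ^+ 2 / 4 and up to the factor
   2 `^ (- nu), of z ^ (n - nu) J_nu^(n) (z), where gam = 1 / Gamma. *)
Definition bessel_coef m : R :=
  (-1) ^+ m / m`!%:R * \prod_(j < n) (2 * m%:R + nu - j%:R) * gam (nu + m%:R + 1).

(* Up to the factor 2, the sequence nu - (n - 1), ..., nu, nu + 1, nu + 2, ...,
   which is positive from the index k on when n - k - 1 < nu. *)
Let c (i : nat) : R :=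
  if (i < n)%N then (nu - (n.-1 - i)%:R) / 2 else nu + 1 + (i - n)%:R.

(** Up to a constant, the polynomial [wb N] below with its variable divided by [(n + N.+1) * N.+1]:
    the first factor sends the binomial coefficient to 1 / m!, the second belongs to Gauss's
    formula. *)
Let u m0 N m : R := (-1) ^+ m * ('C(n + N.+1, m)%:R * (n + N.+1)%:R ^- m) *
  \prod_(j < n) (2 * m%:R + nu - j%:R) * gauss_quotient gam nu m0 N m.

Let u_cvg m0 m : 0 < nu + m0%:R + 1 -> u m0 ^~ m @ \oo --> bessel_coef m.
Proof.
move=> h; apply: cvgM; last exact: gauss_quotient_cvg.
apply: cvgM; last exact: cvg_cst.
by apply: cvgM; [exact: cvg_cst|exact: binomial_ratio_cvg].
Qed.

Lemma prod_le_exp m : `|\prod_(j < n) (2 * m%:R + nu - j%:R)| <=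
  (2 + `|nu| + n%:R) ^+ n * (2 ^+ n) ^+ m.
Proof.
rewrite normr_prod exprAC -exprMn -[X in _ ^+ X]card_ord -prodr_const.
apply: ler_prod => j _; rewrite normr_ge0 /=.
have m2 : m%:R <= 2 ^+ m :> R by rewrite -natrX ler_nat ltnW// ltn_expl.
have o2 : 1 <= 2 ^+ m :> R by rewrite exprn_ege1// ler1n.
have jn : j%:R <= n%:R :> R by rewrite ler_nat ltnW.
apply: le_trans (ler_normB _ _) _; apply: le_trans (lerD (ler_normD _ _) (lexx _)) _.
rewrite normrM !normr_nat.
have := normr_ge0 nu; have : 0 <= n%:R :> R by []; nra.
Qed.

Let u_bound m0 : 0 < nu + m0%:R + 1 -> exists K B : R, [/\ 0 <= K, 0 < B &
  \forall N \near \oo, forall m, `|u m0 N m| <= K * B ^+ m].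
Proof.
move=> /(gauss_quotient_bound gamS gam_gt0)[K [B [K0 B1 H]]].
have B0 : 0 < B by exact: lt_le_trans B1.
have n0 : 0 <= (2 + `|nu| + n%:R) ^+ n :> R by rewrite exprn_ge0// !addr_ge0.
exists ((2 + `|nu| + n%:R) ^+ n * K), (2 ^+ n * B); split; first exact: mulr_ge0.
  by rewrite mulr_gt0// exprn_gt0.
apply: filterS H => N H m.
rewrite /u 2!normrM exprMn mulrACA; apply: ler_pM => //.
rewrite normrM normrX normrN1 expr1n mul1r ger0_norm ?mulr_ge0 ?invr_ge0 ?exprn_ge0//.
rewrite -[leRHS]mul1r; apply: ler_pM; rewrite ?mulr_ge0 ?invr_ge0 ?exprn_ge0//.
  by apply: binomial_ratio_le; rewrite addnS.
exact: prod_le_exp.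
Qed.

Lemma ex_pos_shift : exists m0 : nat, 0 < nu + m0%:R + 1.
Proof. by exists (Num.truncn (- nu)).+1; have := truncnS_gt (- nu); lra. Qed.

Lemma exp_type_bessel_coef : exp_type (fun m => (bessel_coef m)%:C).
Proof.
have [m0 h] := ex_pos_shift.
have [K [B [K0 B1 H]]] := gauss_quotient_bound gamS gam_gt0 h.
have B0 : 0 <= B by exact: le_trans B1.
have n0 : 0 <= (2 + `|nu| + n%:R) ^+ n :> R by rewrite exprn_ge0// !addr_ge0.
exists ((2 + `|nu| + n%:R) ^+ n * K), (2 ^+ n * B); split; rewrite ?mulr_ge0 ?exprn_ge0//.
move=> m; rewrite cmod_real /bessel_coef -mulrA normrM normrM normrX normrN1 expr1n mul1r.
rewrite mulrC mulrA; apply: ler_pM => //; last by rewrite normfV normr_nat.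
rewrite normrM exprMn mulrACA; apply: ler_pM => //; first exact: prod_le_exp.
have /cvg_norm L := @gauss_quotient_cvg _ _ _ gamS gam_gt0 m0 h m.
by apply: (cvgr_to_le L); apply: filterS H => N.
Qed.

Let wb N : {poly R} := weighted_binom (n + N.+1) c (n + N.+1).

Let wb_coef N m : (wb N)`_m = (-1) ^+ m * 'C(n + N.+1, m)%:R *
  (2 ^- n * \prod_(j < n) (2 * m%:R + nu - j%:R) *
  \prod_(j < N.+1) (m%:R + nu + 1 + j%:R)).
Proof.
rewrite coef_poly; case: ltnP => mT; last by rewrite bin_small// mulr0 mul0r.
congr (_ * _); rewrite big_split_ord /=; congr (_ * _).
  rewrite (reindex_inj rev_ord_inj) /= -exprVn -[X in _ ^+ X]card_ord -prodr_const -big_split /=.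
  apply: eq_bigr => j _; rewrite /c.
  have -> : (n - j.+1 < n)%N by rewrite ltn_subLR// addSn ltnS leq_addl.
  have -> : (n.-1 - (n - j.+1))%N = j by have := ltn_ord j; lia.
  by field.
apply: eq_bigr => j _; rewrite /c ltnNge leq_addr /= addKn; ring.
Qed.

Let wb_u m0 N : 0 < nu + m0%:R + 1 -> exists2 t : R, t != 0 &
  forall m, u m0 N m = t * ((wb N)`_m * (((n + N.+1) * N.+1)%:R ^- m)).
Proof.
move=> h; have k0 := kappa_gt0 gam_gt0 h N.
set ka := (X in 0 < X) in k0.
exists (2 ^+ n / ka); first by rewrite mulf_neq0// ?expf_neq0// invr_eq0 gt_eqF.
move=> m'; rewrite wb_coef /u /gauss_quotient -/ka natrM exprMn.
have k0' : ka != 0 by rewrite gt_eqF.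
have T0 : (n + N.+1)%:R ^+ m' != 0 :> R by rewrite expf_neq0// pnatr_eq0 addnS.
have N0 : N.+1%:R ^+ m' != 0 :> R by rewrite expf_neq0// pnatr_eq0.
have n0 : 2 ^+ n != 0 :> R by rewrite expf_neq0.
move: ((n + N.+1)%:R ^+ m') (N.+1%:R ^+ m') (2 ^+ n) T0 N0 n0 => x y z x0 y0 z0.
by field; rewrite x0 y0 z0 k0'.
Qed.

Variable k : nat.
Hypothesis nuk : n%:R - k%:R - 1 < nu.

Lemma bessel_series_factor : exists r (b : nat -> R[i]) g, [/\ bessel_coef r != 0, exp_type g,
  forall w, ~ (complex.Im w = 0 /\ 0 <= complex.Re w) -> psum g w != 0 &
  forall w, psum (fun m => (bessel_coef m)%:C) w =
    (bessel_coef r)%:C * w ^+ r * (\prod_(i < k) (1 - b i * w)) * psum g w].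
Proof.
have [m0 h] := ex_pos_shift.
have exr : exists r, bessel_coef r != 0.
  exists (n + m0.+1)%N; rewrite /bessel_coef !mulf_neq0//.
  - by rewrite signr_eq0.
  - apply/prodf_neq0 => j _; rewrite gt_eqF//.
    have : j%:R <= n%:R :> R by rewrite ler_nat ltnW.
    rewrite natrD -natr1; have : 0 <= n%:R :> R by []; have : 0 <= m0%:R :> R by []; lra.
  - rewrite gt_eqF// gam_gt0//; rewrite natrD -natr1; have : 0 <= n%:R :> R by []; lra.
pose r := ex_minn exr.
have [Ar rmin] : bessel_coef r != 0 /\ forall m, (m < r)%N -> bessel_coef m = 0.
  rewrite /r; case: ex_minnP => r' Ar' H; split => // m mr.
  by apply/eqP; apply: contraTT mr => /H; rewrite -leqNgt.
have cpos N i : (k <= i < n + N.+1)%N -> 0 < c i.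
  move=> /andP[ki _]; have ki' : k%:R <= i%:R :> R by rewrite ler_nat.
  rewrite /c; case: ltnP => iN; last first.
    rewrite natrB//. have := nuk; move: (n%:R : R) (k%:R : R) (i%:R : R) ki' => x y z; lra.
  rewrite divr_gt0// natrB; last by lia.
  have -> : n.-1%:R = n%:R - 1 :> R by rewrite -subn1 natrB//; lia.
  have := nuk; move: (n%:R : R) (k%:R : R) (i%:R : R) ki' => x y z; lra.
have nearr : \forall N \near \oo, (wb N)`_r != 0.
  have [Ar0|Ar0] : 0 < bessel_coef r \/ bessel_coef r < 0 by apply/orP; rewrite -neq_lt eq_sym.
  - have /cvgr_gt/(_ _ Ar0) := @u_cvg m0 r h; apply: filterS => N.
    have [t _ ->] := wb_u N h => H; apply: contraTneq H => ->.
    by rewrite mul0r mulr0 ltxx.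
  - have /cvgr_lt/(_ _ Ar0) := @u_cvg m0 r h; apply: filterS => N.
    have [t _ ->] := wb_u N h => H; apply: contraTneq H => ->.
    by rewrite mul0r mulr0 ltxx.
(* A coefficient vanishes either through the product over [j < n], which [wb N] contains as well, or
   through a zero of [gam], which becomes a zero factor in [wb N] once [N] is large enough. So
   [wb N] has the same order [r] at 0. *)
have near0 : \forall N \near \oo, forall m : 'I_r, (wb N)`_m = 0.
  apply: filter_forall => m; have /eqP := rmin m (ltn_ord m).
  rewrite /bessel_coef mulf_eq0 => /orP[|/eqP/(gam_eq0 gamS gam_gt0)[j Hj]].
    rewrite !mulf_eq0 signr_eq0/= invr_eq0 pnatr_eq0 -leqn0 leqNgt fact_gt0 /= => /eqP P0.
    by apply: filterE => N; rewrite wb_coef P0 mulr0 mul0r mulr0.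
  near=> N; have jN : (j < N.+1)%N by rewrite ltnS; near: N; exact: nbhs_infty_ge.
  rewrite wb_coef (bigD1 (Ordinal jN)) //= (_ : m%:R + nu + 1 + j%:R = 0) ?mul0r ?mulr0//.
  by rewrite -Hj; ring.
have [N1 _ HN1] : \forall N \near \oo, (wb N)`_r != 0 /\ forall m : 'I_r, (wb N)`_m = 0.
  by apply: filterS2 nearr near0.
have /choice[p Hp] N : exists p : R[i] * (nat -> R[i]) * seq R,
    all (fun x => 0 <= x) p.2 /\ forall m,
    (p.1.1 *: ((\prod_(i < k) (1 - (p.1.2 i)%:P * 'X)) * lin_prod [seq x%:C | x <- p.2]))`_m =
    (u m0 (N + N1) (m + r))%:C.
  have [s [q [E s0 qk]]] := weighted_binom_factor (cpos (N + N1)%N).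
  have [wr w0] := HN1 (N + N1)%N (leq_addl _ _).
  pose l : R := ((n + (N + N1).+1) * (N + N1).+1)%:R^-1.
  have l0 : 0 <= l by rewrite invr_ge0.
  have [c' [b [t [t0 H]]]] := linear_factors_form l0 E s0 qk wr
    (fun m mr => w0 (Ordinal mr)).
  have [v _ Hv] := wb_u (N + N1) h.
  exists ((v * l ^+ r)%:C * c', b, t); split => //= m.
  rewrite -scalerA coefZ H -rmorphM Hv; congr (_%:C).
  rewrite exprVn exprVn exprD invfM -/(wb _); ring.
have [K [B [K0 B0 uB]]] := u_bound h.
pose a m := (bessel_coef (m + r))%:C : R[i].
have shift_near (Q : nat -> Prop) : (\forall N \near \oo, Q N) -> \forall N \near \oo, Q (N + N1)%N.
  by case=> M _ HM; exists M => // N /= MN; apply: HM => /=; rewrite (leq_trans MN)// leq_addr.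
have [|||||b [g [gt gn ag]]] := @hurwitz_limit R k
  (fun N => (p N).1.1 *: ((\prod_(i < k) (1 - ((p N).1.2 i)%:P * 'X)) * lin_prod [seq x%:C | x <- (p N).2]))
  (fun N => (p N).1.1) (fun N => (p N).1.2) (fun N => (p N).2) a (K * B ^+ r) B _ B0 (fun N => erefl).
- by rewrite mulr_ge0// exprn_ge0// ltW.
- by move=> N; have [] := Hp N.
- apply: filterS (shift_near _ uB) => N H m; have [_ ->] := Hp N.
  by rewrite cmod_real -mulrA -exprD [(r + m)%N]addnC; exact: H.
- move=> m; split => /=.
    apply: (cvg_eq_near (u := fun N => u m0 (N + N1) (m + r))); last first.
      by apply: filterE => N; have [_ ->] := Hp N.
    by have := @u_cvg m0 (m + r) h; rewrite -(cvg_shiftn N1).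
  apply: (cvg_eq_near (cvg_cst _)).
  by apply: filterE => N; have [_ ->] := Hp N.
- by rewrite /a add0n fmorph_eq0.
exists r, b, g; split => // w.
have ea := exp_type_bessel_coef.
have la : exp_type (lin_mulseq b k g) by exact: exp_type_lin_mulseq.
have es j : exp_type (fun m => (bessel_coef (m + j))%:C).
  elim: j => [|j IH]; first by under eq_fun do rewrite addn0.
  by under eq_fun do rewrite addnS -addSn; exact: exp_type_succ IH.
have H j : (j <= r)%N -> psum (fun m => (bessel_coef m)%:C) w =
    w ^+ j * psum (fun m => (bessel_coef (m + j))%:C) w.
  elim: j => [|j IH] jr; first by rewrite mul1r; under [in RHS]eq_fun do rewrite addn0.
  rewrite IH ?(ltnW jr)// exprSr -mulrA -psum_pshift//; congr (_ * _).
  by apply: eq_psum => -[|m] /=; [rewrite add0n rmin|rewrite addSnnS].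
rewrite (H r (leqnn r)) (@eq_psum _ _ (fun m => a 0%N * lin_mulseq b k g m) _ ag).
rewrite psumM// psum_lin_mulseq// /a add0n; ring.
Unshelve. all: by end_near. Qed.

(** With [d i] a square root of [b i * sigma], each factor in [w] splits into (1 - d z)(1 + d z).
    The rest has no nonreal zero: for nonreal [z], the number sigma z^2 lies off [0, +oo[. *)
Lemma at_most_nonreal_zeros_bessel (C : R[i]) (sigma : R) : C != 0 -> 0 < sigma ->
  at_most_nonreal_zeros
    (fun z => C * psum (fun m => (bessel_coef m)%:C) (sigma%:C * z ^+ 2)) (2 * k).
Proof.
move=> C0 s0; have [r [b [g [Ar gt gn E]]]] := bessel_series_factor.
pose d i := sqrtc (b i * sigma%:C).
pose gs := flatten [seq [:: d i; - d i] | i <- iota 0 k].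
have -> : (2 * k = size gs)%N.
  have H l : size (flatten [seq [:: d i; - d i] | i <- l]) = (2 * size l)%N.
    by elim: l => //= x l ->; lia.
  by rewrite H size_iota.
have sq n' : smooth n' (fun z : R[i] => sigma%:C * z ^+ 2).
  apply: smoothM; first exact: smooth_cst.
  by apply: smoothM; exact: smooth_id.
pose K z := C * (bessel_coef r)%:C * (sigma%:C * z ^+ 2) ^+ r * psum g (sigma%:C * z ^+ 2).
apply: (@at_most_nonreal_zeros_prod _ gs _ K).
- move=> n'; apply: smoothM; last by apply: (@smooth_comp _ _ (psum g)) => //; exact: smooth_psum.
  apply: smoothM; first exact: smooth_cst.
  elim: r {Ar E K} => [|r IH]; first exact: smooth_cst.
  by under eq_fun do rewrite exprS; exact: smoothM.
- move=> z Iz; have z0 : z != 0 by apply: contra_neq Iz => ->.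
  have s1 : sigma%:C != 0 by rewrite fmorph_eq0 gt_eqF.
  have A1 : (bessel_coef r)%:C != 0 by rewrite fmorph_eq0.
  rewrite /K mulf_neq0//; first by rewrite mulf_neq0 ?expf_neq0 ?mulf_neq0// expf_neq0.
  apply: gn => -[]; rewrite expr2 !ImM !ReM !ImM /= !mul0r subr0 addr0.
  move: (complex.Re z) (complex.Im z) Iz => x y y0 /eqP.
  rewrite [y * x]mulrC -mulr2n mulf_eq0 gt_eqF//= mulrn_eq0 /= mulf_eq0 (negPf y0) orbF => /eqP ->.
  rewrite mul0r sub0r pmulr_rge0// oppr_ge0 -expr2 leNgt.
  by rewrite lt_def sqr_ge0 sqrf_eq0 y0.
- move=> z; rewrite E /K.
  have -> : \prod_(c0 <- gs) (1 - c0 * z) = \prod_(i < k) (1 - b i * (sigma%:C * z ^+ 2)).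
    rewrite /gs big_flatten /= big_map -(big_mkord xpredT (fun i => 1 - b i * (sigma%:C * z ^+ 2))) /index_iota subn0.
    apply: eq_bigr => i _; rewrite !big_cons big_nil mulr1.
    have -> : b i * (sigma%:C * z ^+ 2) = d i ^+ 2 * z ^+ 2 by rewrite /d sqr_sqrtc mulrA.
    ring.
  ring.
Qed.
End NonrealZeros.

(** * Complex powers *)

Section ComplexPower.
Variable R : realType.
Implicit Types (z w h : R[i]) (x y a e r : R).

Lemma slit_planeP z : slit_plane z -> 0 < cmod z + complex.Re z.
Proof.
move=> sz; have := Re_le_cmod z; rewrite ler_norml => /andP[H _].
have H' : 0 <= cmod z + complex.Re z by lra.
rewrite lt_def H' andbT; apply/eqP => H0.
have := cmod_sqr z; have -> : cmod z = - complex.Re z by lra.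
rewrite sqrrN => /eqP; rewrite -[X in X == _]addr0 (inj_eq (addrI _)) eq_sym sqrf_eq0 => /eqP Iz.
by apply: sz; split => //; have := cmod_ge0 z; lra.
Qed.

Lemma slit_planeN z : 0 < cmod z + complex.Re z -> slit_plane z.
Proof.
case: z => x y /= H [/= y0 x0]; move: H; rewrite y0 cmod_real ler0_norm//.
by rewrite addNr ltxx.
Qed.

Lemma slit_plane_neq0 z : slit_plane z -> z != 0.
Proof. by move=> /slit_planeP H; apply: contraTneq H => ->; rewrite cmod0 addr0 ltxx. Qed.

(** The tangent of half the argument. Its denominator is positive on the slit plane, so [Arg]
    becomes a visibly continuous expression, without the case distinction on the sign of the
    imaginary part. *)
Definition half_tan z : R := complex.Im z / (cmod z + complex.Re z).

Lemma half_tan_sqr z : slit_plane z ->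
  half_tan z ^+ 2 = (cmod z - complex.Re z) / (cmod z + complex.Re z).
Proof.
move=> sz; have H := lt0r_neq0 (slit_planeP sz).
rewrite /half_tan exprMn -[complex.Im z ^+ 2](addKr (complex.Re z ^+ 2)) -cmod_sqr.
by field.
Qed.

Lemma cos_half_tan z : slit_plane z -> cos (atan (half_tan z) *+ 2) = complex.Re z / cmod z.
Proof.
move=> sz; have H := lt0r_neq0 (slit_planeP sz).
have z0 : cmod z != 0 by rewrite cmod_eq0 slit_plane_neq0.
have u0 : 0 <= 1 + half_tan z ^+ 2 by rewrite addr_ge0 ?sqr_ge0.
rewrite cos_mulr2n cos_atan exprVn sqr_sqrtr// half_tan_sqr//.
have -> : 1 + (cmod z - complex.Re z) / (cmod z + complex.Re z) = 2 * cmod z / (cmod z + complex.Re z).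
  by field.
by rewrite -mulr_natr; field; rewrite z0 H.
Qed.

Lemma sin_half_tan z : slit_plane z -> sin (atan (half_tan z) *+ 2) = complex.Im z / cmod z.
Proof.
move=> sz; have H := lt0r_neq0 (slit_planeP sz).
have z0 : cmod z != 0 by rewrite cmod_eq0 slit_plane_neq0.
have u0 : 0 <= 1 + half_tan z ^+ 2 by rewrite addr_ge0 ?sqr_ge0.
have c0 : cos (atan (half_tan z)) != 0.
  by rewrite gt_eqF// cos_gt0_pihalf// atan_gtNpi2 atan_ltpi2.
have -> : sin (atan (half_tan z) *+ 2) = 2 * half_tan z * cos (atan (half_tan z)) ^+ 2.
  rewrite sin_mulr2n -{3}[half_tan z]atanK /tan -mulr_natl; field => //.
rewrite cos_atan exprVn sqr_sqrtr// half_tan_sqr//.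
have -> : 1 + (cmod z - complex.Re z) / (cmod z + complex.Re z) = 2 * cmod z / (cmod z + complex.Re z).
  by field.
by rewrite /half_tan; field; rewrite z0 H.
Qed.

Lemma ArgE z : slit_plane z -> Arg z = atan (half_tan z) *+ 2.
Proof.
move=> sz; rewrite /Arg normc_cmod /= -cos_half_tan//.
have := atan_gtNpi2 (half_tan z); have := atan_ltpi2 (half_tan z) => h1 h2.
case: ifPn => Iz.
  have u0 : 0 <= atan (half_tan z).
    by rewrite -(@atan0 R); apply: le_atan; rewrite divr_ge0// ltW// slit_planeP.
  by rewrite cosK// in_itv /= mulr2n; apply/andP; split; lra.
rewrite -ltNge in Iz.
have u0 : atan (half_tan z) <= 0.
  by rewrite -(@atan0 R); apply: le_atan; rewrite /half_tan pmulr_lle0 ?ltW// invr_gt0 slit_planeP.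
by rewrite cosKN ?opprK// mulr2n; apply/andP; split; lra.
Qed.

Definition cexp w : R[i] :=
  (expR (complex.Re w) * cos (complex.Im w)) +i* (expR (complex.Re w) * sin (complex.Im w)).

Definition clog z : R[i] := ln (cmod z) +i* (atan (half_tan z) *+ 2).

Lemma cexpD w h : cexp (w + h) = cexp w * cexp h.
Proof.
by apply: complex_eqP; rewrite ?ReM ?ImM /cexp /= ReD ImD expRD ?cosD ?sinD; ring.
Qed.

Lemma cexp0 : cexp 0 = 1.
Proof. by apply: complex_eqP => /=; rewrite expR0 ?cos0 ?sin0 mul1r. Qed.

Lemma clogK z : slit_plane z -> cexp (clog z) = z.
Proof.
move=> sz; have z0 : 0 < cmod z by rewrite cmod_gt0 slit_plane_neq0.
have z0' := lt0r_neq0 z0.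
by apply: complex_eqP; rewrite /= lnK ?posrE// ?cos_half_tan ?sin_half_tan// mulrCA mulfV// mulr1.
Qed.

Lemma cpowE z a : slit_plane z -> cpow z a = cexp (a%:C * clog z).
Proof.
move=> sz; have z0 := slit_plane_neq0 sz.
rewrite /cpow ArgE// normc_cmod /= /powR cmod_eq0 (negPf z0).
have -> : a%:C * clog z = (a * ln (cmod z)) +i* (a * (atan (half_tan z) *+ 2)).
  by apply: complex_eqP => /=; ring.
by apply: complex_eqP => /=; ring.
Qed.

Lemma real_derive_eps (f : R -> R) x d e : is_derive x (1 : R) f d -> 0 < e ->
  exists2 r : R, 0 < r & forall t, `|t| < r -> `|f (x + t) - f x - d * t| <= e * `|t|.
Proof.
move=> [df <-] e0.
have := df => /cvg_ex -[d0 Hd0].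
have -> : 'D_1 f x = d0 by exact: cvg_lim Hd0.
move/cvgrPdist_le : Hd0 => /(_ e e0).
rewrite near_withinE /= => /nbhs_ballP[r r0 Hr].
exists r => // t tr.
have [->|t0] := eqVneq t 0; first by rewrite addr0 subrr mulr0 subr0 normr0 mulr0.
have := Hr t; rewrite -ball_normE /= sub0r normrN => /(_ tr t0).
rewrite [t *: 1]mulr1 [t + x]addrC distrC /GRing.scale /= => H.
have -> : f (x + t) - f x - d0 * t = t * (t^-1 * (f (x + t) - f x) - d0) by field.
by rewrite normrM mulrC ler_wpM2r.
Qed.

Lemma cderiv_cexp0 : cderiv cexp 0 1.
Proof.
(* The error terms [a1] to [a5] below add up to seven times [e / 8 * cmod h]. *)
move=> e e0; have e8 : 0 < e / 8 by rewrite divr_gt0.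
have [r1 r10 H1] := real_derive_eps (is_derive_expR 0) e8.
have [r2 r20 H2] := real_derive_eps (is_derive_cos 0) e8.
have [r3 r30 H3] := real_derive_eps (is_derive_sin 0) e8.
exists (Num.min (Num.min r1 r2) (Num.min r3 (Num.min 1 (e / 8)))).
  by rewrite !lt_min r10 r20 r30 e8 ltr01.
move=> h; rewrite !lt_min => /andP[/andP[h1 h2] /and3P[h3 h4 h5]].
have hR := Re_le_cmod h; have hI := Im_le_cmod h.
have {}H1 := H1 _ (le_lt_trans hR h1).
have {}H2 := H2 _ (le_lt_trans hI h2).
have {}H3 := H3 _ (le_lt_trans hI h3).
rewrite add0r cexp0 mul1r; move: H1 H2 H3; rewrite !add0r expR0 cos0 sin0 oppr0 mul0r !subr0 ?addr0 !mul1r.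
set x := complex.Re h in hR *; set y := complex.Im h in hI *.
set A := expR x - 1 - x; set B := cos y - 1; set S := sin y - y => H1 H2 H3.
have -> : cexp h - 1 - h =
   (A * cos y + (1 + x) * B) +i* (A * sin y + (1 + x) * S + x * y).
  by apply: complex_eqP; rewrite ?ReD ?ImD ?ReN ?ImN /= -/x -/y /A /B /S; ring.
apply: le_trans (cmod_le_ReIm _) _ => /=.
have c1 : `|cos y| <= 1 by rewrite ler_norml cos_geN1 cos_le1.
have s1 : `|sin y| <= 1 by rewrite ler_norml sin_geN1 sin_le1.
have x1 : `|1 + x| <= 2.
  by apply: le_trans (ler_normD _ _) _; rewrite normr1; lra.
have a1 : `|A * cos y| <= e / 8 * cmod h.
  rewrite normrM -[leRHS]mulr1; apply: ler_pM => //; apply: le_trans H1 _.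
  by rewrite ler_wpM2l// ltW.
have a2 : `|A * sin y| <= e / 8 * cmod h.
  rewrite normrM -[leRHS]mulr1; apply: ler_pM => //; apply: le_trans H1 _.
  by rewrite ler_wpM2l// ltW.
have a3 : `|(1 + x) * B| <= 2 * (e / 8 * cmod h).
  rewrite normrM; apply: ler_pM => //; apply: le_trans H2 _.
  by rewrite ler_wpM2l// ltW.
have a4 : `|(1 + x) * S| <= 2 * (e / 8 * cmod h).
  rewrite normrM; apply: ler_pM => //; apply: le_trans H3 _.
  by rewrite ler_wpM2l// ltW.
have a5 : `|x * y| <= e / 8 * cmod h.
  by rewrite normrM; apply: ler_pM => //; apply: le_trans hR _; exact: ltW.
have := ler_normD (A * cos y) ((1 + x) * B).
have := ler_normD (A * sin y + (1 + x) * S) (x * y).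
have := ler_normD (A * sin y) ((1 + x) * S).
have : 0 <= e / 8 * cmod h by rewrite mulr_ge0 ?cmod_ge0// ltW.
lra.
Qed.

Lemma cderiv_cexp w : cderiv cexp w (cexp w).
Proof.
move=> e e0; have c0 : 0 < cmod (cexp w) + 1 by rewrite ltr_wpDl ?cmod_ge0.
have [r r0 H] := cderiv_cexp0 (divr_gt0 e0 c0).
exists r => // h hr; have := H h hr; rewrite add0r cexp0 mul1r => H'.
have -> : cexp (w + h) - cexp w - cexp w * h = cexp w * (cexp h - 1 - h) by rewrite cexpD; ring.
rewrite cmodM; apply: le_trans (ler_wpM2l (cmod_ge0 _) H') _.
rewrite mulrA ler_wpM2r ?cmod_ge0// mulrCA -[leRHS]mulr1 ler_wpM2l ?(ltW e0)//.
by rewrite ler_pdivrMr// mul1r lerDl.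
Qed.

Lemma cmod_continuous z e : 0 < e -> exists2 r, 0 < r &
  forall h, cmod h < r -> `|cmod (z + h) - cmod z| <= e.
Proof.
move=> e0; exists e => // h hr; rewrite ler_norml; apply/andP; split.
  have := cmodB (z + h) h; rewrite addrK; lra.
have := cmodD z h; lra.
Qed.

Lemma near0_filter : ProperFilter (fun P : set R[i] => exists2 r : R, 0 < r & forall h, cmod h < r -> P h).
Proof.
split; first by move=> [r r0 /(_ 0)]; rewrite cmod0 => /(_ r0).
split; first by exists 1.
- move=> P Q [r r0 HP] [r' r'0 HQ]; exists (Num.min r r'); first by rewrite lt_min r0.
  by move=> h; rewrite lt_min => /andP[h1 h2]; split; [exact: HP|exact: HQ].
by move=> P Q PQ [r r0 HP]; exists r => // h /HP/PQ.
Qed.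

(** Besides continuity this records that the slit plane is open, which allows differentiating
    formulas that hold only there. *)
Lemma clog_continuous z e : slit_plane z -> 0 < e -> exists2 r, 0 < r &
  forall h, cmod h < r -> slit_plane (z + h) /\ cmod (clog (z + h) - clog z) < e.
Proof.
move=> sz e0; have H := slit_planeP sz.
pose F : set_system R[i] := fun P => exists2 r : R, 0 < r & forall h, cmod h < r -> P h.
have FF : ProperFilter F := near0_filter.
have cR : (fun h => complex.Re (z + h)) @ F --> complex.Re z.
  apply/cvgrPdist_lt => d d0; exists d => // h hd /=; rewrite ReD distrC addrC addKr.
  exact: le_lt_trans (Re_le_cmod _) hd.
have cI : (fun h => complex.Im (z + h)) @ F --> complex.Im z.
  apply/cvgrPdist_lt => d d0; exists d => // h hd /=; rewrite ImD distrC addrC addKr.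
  exact: le_lt_trans (Im_le_cmod _) hd.
have cM : (fun h => cmod (z + h)) @ F --> cmod z.
  apply/cvgrPdist_le => d d0; have [r r0 Hr] := cmod_continuous z d0.
  by exists r => // h hr; rewrite distrC Hr.
have cS : (fun h => cmod (z + h) + complex.Re (z + h)) @ F --> cmod z + complex.Re z by exact: cvgD.
have cT : (fun h => half_tan (z + h)) @ F --> half_tan z.
  by apply: cvgM => //; apply: cvgV => //; rewrite gt_eqF.
have cA : (fun h => atan (half_tan (z + h)) *+ 2) @ F --> atan (half_tan z) *+ 2.
  have cA : (fun h => atan (half_tan (z + h))) @ F --> atan (half_tan z).
    exact: (continuous_cvg _ (@continuous_atan R (half_tan z)) cT).
  by rewrite mulr2n; under eq_fun do rewrite mulr2n; exact: cvgD.
have z0 : 0 < cmod z by rewrite cmod_gt0 slit_plane_neq0.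
have cL : (fun h => ln (cmod (z + h))) @ F --> ln (cmod z).
  exact: (continuous_cvg _ (continuous_ln z0) cM).
have e2 : 0 < e / 2 by rewrite divr_gt0.
have F1 : F (fun h => 0 < cmod (z + h) + complex.Re (z + h)) by move/cvgr_gt: cS; apply.
move/cvgrPdist_lt: cA => /(_ _ e2) F2; move/cvgrPdist_lt: cL => /(_ _ e2) F3.
have [r r0 Hr] := filterI F1 (filterI F2 F3).
exists r => // h hr; have /= [h1 [h2 h3]] := Hr h hr; split; first exact: slit_planeN.
apply: le_lt_trans (cmod_le_ReIm _) _; rewrite ReD ImD ReN ImN /= distrC [X in _ + X]distrC; lra.
Qed.

(** An inverse function argument: the increment [k] of [clog] is small by continuity, and [cexp]
    turns it into h = z k + o(k). *)
Lemma cderiv_clog z : slit_plane z -> cderiv clog z z^-1.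
Proof.
move=> sz e e0; have z0 := slit_plane_neq0 sz.
have m0 : 0 < cmod z by rewrite cmod_gt0.
(* The first bound yields [cmod k <= 2 * (cmod h / cmod z)]; the second then makes the error at most
   [e * cmod h]. *)
pose e1 := Num.min (cmod z / 2) (e * cmod z ^+ 2 / 2).
have e10 : 0 < e1 by rewrite lt_min !divr_gt0// mulr_gt0// exprn_gt0.
have [r1 r10 H1] := cderiv_cexp (clog z) e10.
have [r r0 H] := clog_continuous sz r10.
exists r => // h hr; have [szh k1] := H h hr.
set k := clog (z + h) - clog z in k1.
rewrite -/k; have := H1 k k1; rewrite [clog z + k]addrC subrK !clogK// [z + h]addrC addrK => H2.
have hk : cmod (k - z^-1 * h) <= e1 / cmod z * cmod k.
  have -> : k - z^-1 * h = - z^-1 * (h - z * k) by field.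
  by rewrite cmodM cmodN cmodV mulrC mulrAC ler_wpM2r ?invr_ge0 ?cmod_ge0.
have ek : cmod k <= 2 * (cmod h / cmod z).
  have : cmod k <= cmod (k - z^-1 * h) + cmod (z^-1 * h).
    by have := cmodD (k - z^-1 * h) (z^-1 * h); rewrite subrK.
  rewrite cmodM cmodV [(cmod z)^-1 * _]mulrC.
  have : e1 / cmod z <= 1 / 2.
    rewrite ler_pdivrMr//; have : e1 <= cmod z / 2 by rewrite /e1 ge_min lexx.
    lra.
  have := cmod_ge0 k; nra.
have E2 : e1 <= e * cmod z ^+ 2 / 2 by rewrite /e1 ge_min lexx orbT.
apply: le_trans hk _; apply: (@le_trans _ _ ((e * cmod z / 2) * (2 * (cmod h / cmod z)))).
  apply: ler_pM => //; rewrite ?cmod_ge0//; first by rewrite divr_ge0// ltW.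
  by rewrite ler_pdivrMr//; apply: le_trans E2 _; rewrite expr2 le_eqVlt; apply/orP; left; apply/eqP; ring.
by rewrite le_eqVlt; apply/orP; left; apply/eqP; field; rewrite gt_eqF.
Qed.

Lemma cpowD z a b : slit_plane z -> cpow z (a + b) = cpow z a * cpow z b.
Proof. by move=> sz; rewrite !cpowE// -cexpD rmorphD mulrDl. Qed.

Lemma cpow0 z : slit_plane z -> cpow z 0 = 1.
Proof. by move=> sz; rewrite cpowE// mul0r cexp0. Qed.

Lemma cpow_nat z m : slit_plane z -> cpow z m%:R = z ^+ m.
Proof.
move=> sz; elim: m => [|m IH]; first by rewrite cpow0.
by rewrite -natr1 cpowD// IH exprSr cpowE// mul1r clogK.
Qed.

Lemma cderiv_cpow z a : slit_plane z -> cderiv (fun w => cpow w a) z (a%:C * cpow z (a - 1)).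
Proof.
move=> sz; have [r r0 Hr] := clog_continuous sz ltr01.
have z0 := slit_plane_neq0 sz.
apply: (@cderiv_near _ (fun w => cexp (a%:C * clog w)) _ _ _ r) => //.
  by move=> h /Hr[szh _]; rewrite cpowE.
have H : cderiv (fun w => a%:C * clog w) z (a%:C * z^-1).
  by apply: cderiv_eq (cderivM (cderiv_cst a%:C z) (cderiv_clog sz)) _; rewrite mul0r add0r.
apply: cderiv_eq (cderiv_comp H (cderiv_cexp _)) _.
have E : cpow z a = cpow z (a - 1) * z.
  by have := cpowD (a - 1) 1%:R sz; rewrite cpow_nat// expr1 subrK.
by rewrite -cpowE// E; field.
Qed.

Lemma slit_planeZ z a : 0 < a -> slit_plane z -> slit_plane (a%:C * z).
Proof.
move=> a0 sz; apply: slit_planeN; rewrite cmodM cmod_real gtr0_norm// ReM /= mul0r subr0 -mulrDr.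
by rewrite mulr_gt0// slit_planeP.
Qed.

Lemma cpowZ z a b : 0 < a -> slit_plane z -> cpow (a%:C * z) b = (a `^ b)%:C * cpow z b.
Proof.
move=> a0 sz; have sz' := slit_planeZ a0 sz.
have E : half_tan (a%:C * z) = half_tan z.
  have := lt0r_neq0 (slit_planeP sz) => H.
  rewrite /half_tan cmodM cmod_real gtr0_norm// ReM ImM /= !mul0r subr0 addr0.
  by rewrite -mulrDr invfM mulrACA mulfV ?gt_eqF// mul1r.
rewrite /cpow !ArgE// E !normc_cmod /= cmodM cmod_real gtr0_norm// powRM ?(ltW a0) ?cmod_ge0//.
by rewrite rmorphM mulrA.
Qed.
End ComplexPower.

(** * The Gamma function *)

Section GammaFunction.
Variable R : realType.
Implicit Types (x t a b : R).

Let mu := @lebesgue_measure R.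

Definition euler_integrand x t : R := t `^ (x - 1) * expR (- t).
(** The boundary term in the integration by parts that gives the functional equation. *)
Definition euler_primitive x t : R := t `^ x * expR (- t).

Lemma euler_integrand_ge0 x t : 0 <= euler_integrand x t.
Proof. by rewrite mulr_ge0 ?powR_ge0 ?expR_ge0. Qed.

Lemma is_derive_expRN (t k : R) :
  is_derive t (1 : R) (fun s : R => expR (k * s)) (k * expR (k * t)).
Proof.
have d1 : is_derive t (1 : R) (fun s : R => k * s) k.
  apply: is_derive_eq.
  by rewrite /GRing.scale /= mulr1 ?mulr0 ?addr0.
have := @is_derive1_comp R expR (fun s : R => k * s) t _ _ (is_derive_expR _) d1.
by rewrite mulrC.
Qed.

Lemma is_derive_euler_primitive x t : 0 < t -> is_derive t (1 : R) (euler_primitive x)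
  (x * euler_integrand x t - euler_integrand (x + 1) t).
Proof.
move=> t0.
have d1 : is_derive t (1 : R) (fun s : R => s `^ x) (x * t `^ (x - 1)) by exact: is_derive1_powR.
have d2 : is_derive t (1 : R) (fun s : R => expR (- s)) (- expR (- t)).
  by have := is_derive_expRN t (-1); rewrite !mulN1r; under eq_fun do rewrite mulN1r.
apply: is_derive_eq (is_deriveM d1 d2) _.
rewrite /euler_integrand addrK /GRing.scale /=; ring.
Qed.

Lemma euler_primitive_continuous x t : 0 < t -> {for t, continuous (euler_primitive x)}.
Proof.
move=> t0; apply: differentiable_continuous; apply/derivable1_diffP.
by have [] := is_derive_euler_primitive x t0.
Qed.

Lemma euler_integrand_within x a b : 0 < a -> {within `[a, b], continuous (euler_integrand x)}.
Proof.
move=> a0; apply: continuous_in_subspaceT => t; rewrite inE /= in_itv /= => /andP[at_ _].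
exact: (@euler_primitive_continuous (x - 1) t (lt_le_trans a0 at_)).
Qed.

Lemma euler_integrable x a b : 0 < a -> mu.-integrable `[a, b] (EFin \o euler_integrand x).
Proof.
by move=> a0; apply: continuous_compact_integrable; [exact: segment_compact|exact: euler_integrand_within].
Qed.

Lemma euler_integrand_measurable x (A : set R) : measurable_fun A (euler_integrand x).
Proof.
apply: (@measurable_funS _ _ _ _ setT) => //.
apply: measurable_funM; first exact: measurable_powR.
by apply: measurableT_comp => //; exact: measurableT_comp.
Qed.

Lemma euler_integral_parts x a b : 0 < a -> a < b ->
  (x%:E * \int[mu]_(t in `[a, b]) (euler_integrand x t)%:E =
   \int[mu]_(t in `[a, b]) (euler_integrand (x + 1) t)%:E +
   (euler_primitive x b - euler_primitive x a)%:E)%E.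
Proof.
move=> a0 ab.
pose f t := x * euler_integrand x t - euler_integrand (x + 1) t.
have cf : {within `[a, b], continuous f}.
  apply: continuous_in_subspaceT => t; rewrite inE /= in_itv /= => /andP[at_ _].
  have t0 := lt_le_trans a0 at_.
  apply: cvgB; last exact: (@euler_primitive_continuous (x + 1 - 1) t t0).
  by apply: cvgM; [exact: cvg_cst|exact: (@euler_primitive_continuous (x - 1) t t0)].
have If : mu.-integrable `[a, b] (EFin \o f).
  by apply: continuous_compact_integrable => //; exact: segment_compact.
have E : (\int[mu]_(t in `[a, b]) (f t)%:E = (euler_primitive x b)%:E - (euler_primitive x a)%:E)%E.
  apply: continuous_FTC2 => //.
    split.
    - move=> t; rewrite in_itv /= => /andP[at_ _].
      by have [] := is_derive_euler_primitive x (lt_trans a0 at_).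
    - by apply: cvg_at_right_filter; exact: euler_primitive_continuous.
    - by apply: cvg_at_left_filter; exact: euler_primitive_continuous (lt_trans a0 ab).
  move=> t; rewrite in_itv /= => /andP[at_ _].
  have H := is_derive_euler_primitive x (lt_trans a0 at_).
  by rewrite derive1E derive_val.
rewrite EFinB -E -integralZl//; last exact: euler_integrable.
rewrite -integralD//; last exact: euler_integrable.
by apply: eq_integral => t _ /=; rewrite -EFinM -EFinD /f; congr (_%:E); ring.
Qed.

(** The intervals [[lo m, hi m]] exhaust ]0, +oo[. Starting at 2 makes even the first one
    nondegenerate. *)
Let lo (m : nat) : R := m.+2%:R^-1.
Let hi (m : nat) : R := m.+2%:R.

Let lo_gt0 m : 0 < lo m. Proof. by rewrite invr_gt0. Qed.
Let lo_hi m : lo m < hi m.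
Proof.
apply: (@lt_trans _ _ 1); first by rewrite invf_lt1// ltr1n.
by rewrite ltr1n.
Qed.

Lemma euler_integral_cvg (f : R -> R) : (forall t, 0 < t -> 0 <= f t) ->
  (forall A : set R, measurable_fun A f) ->
  (\int[mu]_(t in `[lo m, hi m]) (f t)%:E)%E @[m --> \oo] -->
  (\int[mu]_(t in `]0%R, +oo[) (f t)%:E)%E.
Proof.
move=> f0 mf.
have -> : (`]0%R, +oo[%classic : set R) = \bigcup_m `[lo m, hi m]%classic.
  apply/seteqP; split => t /=; rewrite ?in_itv /= ?andbT.
    move=> t0; have h1 := truncnS_gt t; have h2 := truncnS_gt t^-1.
    move: (Num.truncn t) (Num.truncn t^-1) h1 h2 => p q h1 h2.
    exists (p + q)%N => //=; rewrite in_itv /=.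
    apply/andP; split.
      rewrite /lo -[t]invrK lef_pV2 ?posrE ?invr_gt0// ltW// (lt_le_trans h2)// ler_nat.
      lia.
    rewrite /hi ltW// (lt_le_trans h1)// ler_nat; lia.
  by move=> [m _] /=; rewrite in_itv /= => /andP[mt _]; exact: lt_le_trans (lo_gt0 m) mt.
apply: ge0_nondecreasing_set_cvg_integral.
- move=> m p mp; apply/subsetPset => t /=; rewrite !in_itv /= => /andP[h1 h2]; apply/andP; split.
    by apply: le_trans h1; rewrite lef_pV2 ?posrE// ler_nat.
  by apply: le_trans h2 _; rewrite ler_nat.
- by move=> m; exact: measurable_itv.
- by move=> m; apply/measurable_EFinP; exact: mf.
- by move=> m t /=; rewrite in_itv /= => /andP[mt _]; rewrite lee_fin f0// (lt_le_trans (lo_gt0 m)).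
Qed.

(** Raise t / (2 a) <= exp (t / (2 a)) to the power [a]. *)
Lemma powR_le_expR a : 0 < a -> exists2 C : R, 0 <= C &
  forall t, 0 < t -> t `^ a * expR (- t) <= C * expR (- (t / 2)).
Proof.
move=> a0; exists ((2 * a) `^ a); first exact: powR_ge0.
move=> t t0; have a2 : 0 < 2 * a by rewrite mulr_gt0.
have -> : expR (- (t / 2)) = expR (t / 2) * expR (- t) by rewrite -expRD; congr expR; field.
rewrite mulrA ler_wpM2r ?expR_ge0//.
have tE : t = 2 * a * (t / (2 * a)) by field; rewrite gt_eqF.
have y0 : 0 < t / (2 * a) by rewrite divr_gt0.
rewrite {1}tE powRM ?(ltW a2) ?(ltW y0)// ler_wpM2l ?powR_ge0//.
have -> : t / 2 = t / (2 * a) * a by field; rewrite gt_eqF.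
rewrite expRM; apply: ge0_ler_powR; rewrite ?nnegrE ?expR_ge0 ?(ltW a0) ?(ltW y0)//.
by apply: le_trans (expR_ge1Dx _); rewrite lerDr.
Qed.

Lemma euler_primitive_hi_cvg x : 0 < x -> (fun m => euler_primitive x (hi m)) @ \oo --> (0 : R).
Proof.
move=> /powR_le_expR[C C0 H].
have L : (fun m : nat => 2 * C * m.+1%:R^-1) @ \oo --> (0 : R).
  have E : 2 * C * 0 = 0 by rewrite mulr0.
  by rewrite -[X in _ --> X]E; apply: cvgM; [exact: cvg_cst|exact: cvg_harmonic].
apply: (squeeze_cvgr _ (cvg_cst 0) L); near=> m.
have h0 : 0 < hi m by [].
rewrite mulr_ge0 ?powR_ge0 ?expR_ge0//=; apply: le_trans (H _ h0) _.
have m0 : 0 < 2^-1 * m.+1%:R :> R by rewrite mulr_gt0.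
have -> : 2 * C * m.+1%:R^-1 = C * (2^-1 * m.+1%:R)^-1 by rewrite invfM invrK; ring.
rewrite ler_wpM2l// expRN lef_pV2 ?posrE ?expR_gt0//.
by apply: le_trans (expR_ge1Dx _); rewrite /hi -[m.+2%:R]natr1; lra.
Unshelve. all: by end_near. Qed.

Lemma euler_primitive_lo_cvg x : 0 < x -> (fun m => euler_primitive x (lo m)) @ \oo --> (0 : R).
Proof.
move=> x0.
have L : (fun m : nat => lo m `^ x) @ \oo --> (0 : R).
  have /cvg_at_rightP := powR_cvg0 x0; apply.
  split; first by move=> m; exact: lo_gt0.
  have := @cvg_harmonic R; rewrite -(cvg_shiftn 1); apply: cvg_trans.
  by apply: near_eq_cvg; near=> m; rewrite /harmonic /= addn1.
apply: (squeeze_cvgr _ (cvg_cst 0) L); near=> m.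
rewrite mulr_ge0 ?powR_ge0 ?expR_ge0//= ler_piMr ?powR_ge0//.
by rewrite -expR0 ler_expR oppr_le0 ltW.
Unshelve. all: by end_near. Qed.

Lemma euler_integralS x : 0 < x -> euler_integral (x + 1) = x * euler_integral x.
Proof.
move=> x0.
have m0 y : forall t, 0 < t -> 0 <= euler_integrand y t by move=> t _; exact: euler_integrand_ge0.
have L1 := euler_integral_cvg (m0 x) (euler_integrand_measurable x).
have L2 := euler_integral_cvg (m0 (x + 1)) (euler_integrand_measurable (x + 1)).
have xf : x%:E \is a fin_num by [].
have L3 := cvgeZl xf L1.
have L4 : (fun m => (euler_primitive x (hi m) - euler_primitive x (lo m))%:E) @ \oo --> 0%:E.
  apply: cvg_EFin; first by near=> m.
  rewrite -[X in _ --> X](subrr 0); apply: cvgB; first exact: euler_primitive_hi_cvg.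
  exact: euler_primitive_lo_cvg.
have d : ((\int[mu]_(t in `]0%R, +oo[) (euler_integrand (x + 1) t)%:E)%E +? 0%:E)%E.
  by rewrite fin_num_adde_defl.
have L5 : (fun m => (\int[mu]_(t in `[lo m, hi m]) (euler_integrand (x + 1) t)%:E +
    (euler_primitive x (hi m) - euler_primitive x (lo m))%:E)%E) @ \oo -->
    (\int[mu]_(t in `]0%R, +oo[) (euler_integrand (x + 1) t)%:E)%E.
  by have := cvgeD d L2 L4; rewrite adde0; apply.
have E : (x%:E * \int[mu]_(t in `]0%R, +oo[) (euler_integrand x t)%:E =
   \int[mu]_(t in `]0%R, +oo[) (euler_integrand (x + 1) t)%:E)%E.
  apply: (cvg_unique (@ereal_hausdorff R) L3).
  have -> : (fun m => (x%:E * \int[mu]_(t in `[lo m, hi m]) (euler_integrand x t)%:E)%E) =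
    (fun m => (\int[mu]_(t in `[lo m, hi m]) (euler_integrand (x + 1) t)%:E +
    (euler_primitive x (hi m) - euler_primitive x (lo m))%:E)%E).
    by apply/funext => m; exact: euler_integral_parts.
  exact: L5.
rewrite /euler_integral /Rintegral -E.
(* Finiteness is not known at this point; [fine] sends infinite values to 0, so the equation holds
   in those cases too. *)
case: (\int[mu]_(t in `]0%R, +oo[) (euler_integrand x t)%:E)%E => [r||] //=.
- by rewrite gt0_muley ?lte_fin//= mulr0.
- by rewrite gt0_muleNy ?lte_fin//= mulr0.
Unshelve. all: by end_near. Qed.

Lemma euler_integral_gt0 x : 0 < x -> 0 < euler_integral x.
Proof.
(* The functional equation reduces to exponents y - 1 > 0: then the integrand is at least exp (-2)
   on [1, 2], and [powR_le_expR] bounds the integral. Finiteness matters because [fine] would send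
   +oo to 0. *)
suff H (y : R) : 1 < y -> 0 < euler_integral y.
  move=> x0; have := H (x + 1); rewrite ltrDr euler_integralS// => /(_ x0).
  by rewrite pmulr_rgt0.
move=> y1.
have m0 : forall t, 0 < t -> 0 <= euler_integrand y t by move=> t _; exact: euler_integrand_ge0.
have L := euler_integral_cvg m0 (euler_integrand_measurable y).
rewrite /euler_integral /Rintegral; apply: fine_gt0; apply/andP; split.
  apply: (@lt_le_trans _ _ (\int[mu]_(t in `[1%R, 2%R]) (cst (expR (-2))%:E t))%E).
    rewrite integral_cst//= lebesgue_measure_itv /= lte_fin ltr1n /=.
    by rewrite -EFinB -EFinM lte_fin mulr_gt0 ?expR_gt0//; lra.
  apply: (@le_trans _ _ (\int[mu]_(t in `[1%R, 2%R]) (euler_integrand y t)%:E)%E).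
    apply: ge0_le_integral => //=.
    - by apply/measurable_EFinP; exact: euler_integrand_measurable.
    move=> t; rewrite in_itv /= => /andP[t1 t2]; rewrite lee_fin /euler_integrand.
    rewrite -[leLHS]mul1r; apply: ler_pM; rewrite ?expR_ge0//; last by rewrite ler_expR lerN2.
    have y0 : 0 <= y - 1 by rewrite subr_ge0 ltW.
    by have := ler_powR t1 y0; rewrite powRr0.
  apply: ge0_subset_integral => //=.
  - by apply/measurable_EFinP; exact: euler_integrand_measurable.
  - by move=> t _; rewrite lee_fin euler_integrand_ge0.
  - by move=> t /=; rewrite !in_itv /= andbT => /andP[t1 _]; exact: lt_le_trans t1.
have y1' : 0 < y - 1 by rewrite subr_gt0.
have [C C0 H] := powR_le_expR y1'.
apply: (@le_lt_trans _ _ (2 * C)%:E); last by rewrite ltry.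
apply: (cvge_to_le L); near=> m.
apply: (@le_trans _ _ (\int[mu]_(t in `[lo m, hi m]) (C * expR (- 2^-1 * t))%:E)%E).
  apply: ge0_le_integral => //=.
  - by move=> t _; rewrite lee_fin euler_integrand_ge0.
  - by apply/measurable_EFinP; exact: euler_integrand_measurable.
  - apply/measurable_EFinP; apply: measurable_funM => //.
    by apply: measurableT_comp => //; exact: measurable_funM.
  move=> t; rewrite in_itv /= => /andP[t1 _]; rewrite lee_fin.
  have -> : - 2^-1 * t = - (t / 2) by field.
  exact: H (lt_le_trans (lo_gt0 m) t1).
pose F t := - 2 * C * expR (- 2^-1 * t).
have dF t : is_derive t (1 : R) F (C * expR (- 2^-1 * t)).
  have d1 : is_derive t (1 : R) (fun=> - 2 * C : R) 0 by exact: is_derive_cst.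
  apply: is_derive_eq (is_deriveM d1 (is_derive_expRN t (- 2^-1))) _.
  by rewrite /GRing.scale /=; field.
have cF t : {for t, continuous F}.
  by apply: differentiable_continuous; apply/derivable1_diffP; have [] := dF t.
rewrite (@continuous_FTC2 _ _ F)//.
- rewrite -EFinB lee_fin /F.
  have h1 : expR (- 2^-1 * lo m) <= 1.
    by rewrite -expR0 ler_expR mulNr oppr_le0 mulr_ge0// ltW.
  have h2 := expR_ge0 (- 2^-1 * hi m); nra.
- apply: continuous_in_subspaceT => t _.
  have -> : (fun t => C * expR (- 2^-1 * t)) = (fun t => - 2^-1 * F t).
    by apply/funext => u; rewrite /F; field.
  by apply: cvgM; [exact: cvg_cst|exact: cF].
- split.
  + by move=> t _; have [] := dF t.
  + by apply: cvg_at_right_filter; exact: cF.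
  + by apply: cvg_at_left_filter; exact: cF.
- by move=> t _; have := dF t => dFt; rewrite derive1E derive_val.
Unshelve. all: by end_near. Qed.
End GammaFunction.

(** Both sides are 0 at the poles, thanks to the convention on inverses. For [x + 1 <= 0] the
    integer shift in [Gamma x] is one more than in [Gamma (x + 1)]. *)
Lemma GammaV (R : realType) (x : R) : (Gamma x)^-1 = x * (Gamma (x + 1))^-1.
Proof.
have [x0|x0] := ltP 0 x.
  rewrite /Gamma x0 addr_gt0// euler_integralS// invfM mulrA mulfV ?mul1r// gt_eqF//.
have [x1|x1] := ltP 0 (x + 1).
  rewrite /Gamma ltNge x0 /= x1.
  have -> : Num.truncn (- x) = 0%N by apply: truncn_def; rewrite oppr_ge0 x0 /=; lra.
  by rewrite big_ord_recl big_ord0 addr0 mulr1 invf_div.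
rewrite /Gamma !ltNge x0 x1 /=.
set m := Num.truncn (- (x + 1)).
have /andP[m1 m2] : m%:R <= - (x + 1) < m.+1%:R by apply: truncn_itv; rewrite oppr_ge0.
have -> : Num.truncn (- x) = m.+1.
  by apply: truncn_def; rewrite -[m.+2%:R]natr1 -natr1; rewrite -natr1 in m2; apply/andP; split; lra.
rewrite big_ord_recl addr0.
have -> : \prod_(i < m.+1) (x + (lift ord0 i)%:R) = \prod_(i < m.+1) (x + 1 + i%:R).
  by apply: eq_bigr => i _; rewrite lift0 -natr1; ring.
have -> : x + m.+2%:R = x + 1 + m.+1%:R by rewrite -natr1; ring.
by rewrite !invf_div mulrA.
Qed.

Lemma GammaV_gt0 (R : realType) (x : R) : 0 < x -> 0 < (Gamma x)^-1.
Proof. by move=> x0; rewrite invr_gt0 /Gamma x0 euler_integral_gt0. Qed.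

(** * Derivatives of the Bessel functions *)

Section BesselDerivatives.
Variable R : realType.
Implicit Types (z w : R[i]) (nu : R).

Lemma real_complexM (x y : R) : (x * y)%:C = x%:C * y%:C.
Proof. exact: rmorphM. Qed.
Lemma real_complexD (x y : R) : (x + y)%:C = x%:C + y%:C.
Proof. exact: rmorphD. Qed.
Lemma real_complexV (x : R) : x^-1%:C = x%:C^-1.
Proof. exact: fmorphV. Qed.
Lemma real_complexX (x : R) m : (x ^+ m)%:C = x%:C ^+ m.
Proof. exact: rmorphXn. Qed.
Lemma real_complex_nat m : (m%:R : R)%:C = m%:R.
Proof. exact: rmorph_nat. Qed.
Lemma real_complex_sign m : (((-1) ^+ m : R)%:C) = (-1) ^+ m.
Proof. by rewrite real_complexX; congr (_ ^+ m); exact: rmorphN1. Qed.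
Definition real_complex_morph :=
  (real_complex_sign, real_complexM, real_complexV, real_complexX, real_complex_nat).

Let rgamma (x : R) : R := (Gamma x)^-1.

Lemma clim_lim (v : nat -> R[i]) l : clim \oo v l -> limn v = l.
Proof.
move=> vl; apply: cvg_lim; first exact: norm_hausdorff.
apply/cvgrPdist_le => e e0.
have e0' : 0 < complex.Re e by case: e e0 => a b /=; rewrite ltcE /= => /andP[].
have -> : e = (complex.Re e)%:C by rewrite RRe_real// ger0_real// ltW.
apply: filterS (clim_epsP vl e0') => m.
by rewrite normc_cmod lecR cmodC.
Qed.

Definition bessel_series nu n w := psum (fun m => (bessel_coef rgamma nu n m)%:C) w.

Lemma exp_type_bessel nu n : exp_type (fun m => (bessel_coef rgamma nu n m)%:C).
Proof. exact: (exp_type_bessel_coef nu (@GammaV R) (@GammaV_gt0 R)). Qed.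

Lemma besselJE nu z : slit_plane z ->
  besselJ nu z = (2 `^ (- nu))%:C * cpow z nu * bessel_series nu 0 ((4^-1)%:C * z ^+ 2).
Proof.
move=> sz; apply: clim_lim.
apply: (clim_near (climM (clim_cst ((2 `^ (- nu))%:C * cpow z nu))
  (psum_lim ((4^-1)%:C * z ^+ 2) (exp_type_bessel nu 0)))); apply: filterE => N.
rewrite mulr_sumr; apply: eq_bigr => m _.
have -> : z / 2 = (2^-1)%:C * z by rewrite !real_complex_morph mulrC.
rewrite cpowZ// ?invr_gt0// cpowD//.
have -> : 2 * m%:R = (2 * m)%:R :> R by rewrite natrM.
rewrite cpow_nat// powRD; last by rewrite invr_eq0 pnatr_eq0 implybT.
rewrite powR_mulrn ?invr_ge0// /bessel_coef big_ord0 mulr1 /rgamma.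
have -> : 2 `^ (- nu) = (2^-1) `^ nu :> R.
  by rewrite -powR_inv1// -powRrM mulN1r.
rewrite !real_complex_morph.
have -> : (4%:R : R[i]) = 2 ^+ 2 by rewrite -natrX.
rewrite exprMn -!exprVn -!exprM invfM; ring.
Qed.

(** The new factor 2 m + nu - n of the m-th coefficient is the action of nu - n + 2 w d/dw. *)
Lemma bessel_seriesS nu n w : bessel_series nu n.+1 w =
  (nu - n%:R)%:C * bessel_series nu n w +
  2 * w * psum (pderiv (fun m => (bessel_coef rgamma nu n m)%:C)) w.
Proof.
have h := exp_type_bessel nu n.
have h' := exp_type_pshift (exp_type_pderiv h).
rewrite -mulrA -psum_pshift; last exact: exp_type_pderiv.
rewrite /bessel_series -!psumM// -psumD; [|exact: exp_typeM|exact: exp_typeM].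
apply: eq_psum => -[|m] /=.
  rewrite mulr0 addr0 -real_complexM; congr (_%:C).
  by rewrite /bessel_coef big_ord_recr /=; ring.
rewrite /pderiv mulrA -natrM -real_complex_nat -!real_complexM -real_complexD; congr (_%:C).
by rewrite /bessel_coef big_ord_recr /= natrM; ring.
Qed.

(** With w = z^2 / 4, differentiating z^(nu - n) f(w) gives z^(nu - n - 1) ((nu - n) f + 2 w f'),
    the right side of [bessel_seriesS]. *)
Lemma derive1n_besselJ nu n z : slit_plane z ->
  derive1n n (besselJ nu) z =
  (2 `^ (- nu))%:C * cpow z (nu - n%:R) * bessel_series nu n ((4^-1)%:C * z ^+ 2).
Proof.
elim: n z => [|n IH] z sz; first by rewrite subr0 -besselJE.
have [r r0 Hr] := clog_continuous sz ltr01.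
rewrite derive1nS.
apply: cderiv_derive1.
apply: (@cderiv_near _ (fun w => (2 `^ (- nu))%:C * cpow w (nu - n%:R) *
  bessel_series nu n ((4^-1)%:C * w ^+ 2)) _ _ _ r r0).
  by move=> h /Hr[szh _]; rewrite IH.
have H2 : cderiv (fun w => (4^-1)%:C * w ^+ 2) z (z / 2).
  apply: cderiv_eq (cderivM (cderiv_cst _ z) (cderivM (cderiv_id z) (cderiv_id z))) _.
  rewrite mul0r add0r mul1r mulr1 !real_complex_morph.
  by rewrite -[4%:R]/((2 * 2)%:R) natrM; field.
have H1 := cderivM (cderiv_cst (2 `^ (- nu))%:C z) (cderiv_cpow (nu - n%:R) sz).
apply: cderiv_eq (cderivM H1 (cderiv_comp H2 (cderiv_psum _ (exp_type_bessel nu n)))) _.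
rewrite mul0r add0r -/(bessel_series nu n _) bessel_seriesS.
have -> : nu - n.+1%:R = nu - n%:R - 1 by rewrite -natr1; ring.
have -> : cpow z (nu - n%:R) = cpow z (nu - n%:R - 1) * z.
  by have := cpowD (nu - n%:R - 1) 1%:R sz; rewrite cpow_nat// expr1 subrK.
have -> : 2 * ((4^-1)%:C * z ^+ 2) = z * (z / 2).
  rewrite !real_complex_morph -[4%:R]/((2 * 2)%:R) natrM; by field.
ring.
Qed.

Lemma entire_bessel_series nu n (C : R[i]) (sigma : R) :
  entire (fun z => C * bessel_series nu n (sigma%:C * z ^+ 2)).
Proof.
move=> z; have [f [Hf _]] : smooth 1 (fun z => C * bessel_series nu n (sigma%:C * z ^+ 2)).
  apply: smoothM; first exact: smooth_cst.
  apply: (@smooth_comp _ _ (bessel_series nu n)); first exact: smooth_psum (exp_type_bessel nu n).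
  apply: smoothM; first exact: smooth_cst.
  by apply: smoothM; exact: smooth_id.
exact: cderiv_derivable (Hf z).
Qed.

Lemma bessel_nonreal_zeros nu n k (C : R[i]) (sigma : R) : C != 0 -> 0 < sigma ->
  n%:R - k%:R - 1 < nu ->
  at_most_nonreal_zeros (fun z => C * bessel_series nu n (sigma%:C * z ^+ 2)) (2 * k).
Proof.
move=> C0 s0 nuk.
exact: (at_most_nonreal_zeros_bessel (@GammaV R) (@GammaV_gt0 R) nuk C0 s0).
Qed.
End BesselDerivatives.

Theorem theorem4 (R : realType) (n : nat) (nu : R) :
  exists F G : R[i] -> R[i],
    [/\ entire_extension
          (fun z => cpow z (n%:R - nu) * derive1n n (besselJ nu) z) F,
        entire_extension
          (fun z => (2 `^ nu)%:C * cpow z (nu + n%:R)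
                      * derive1n n (besselJ (- nu)) (2 * z)) G &
        [/\ n%:R - 1 < nu -> forall z, F z = 0 -> complex.Im z = 0,
            0 <= nu -> at_most_nonreal_zeros G (2 * Num.truncn nu + 2 * n),
            forall s : nat,
              n%:R - 2 * s%:R - 2 < nu < n%:R - 2 * s%:R - 1 ->
              at_most_nonreal_zeros F (4 * s + 2) &
            forall s : nat, (0 < s)%N ->
              n%:R - 2 * s%:R - 1 < nu < n%:R - 2 * s%:R ->
              at_most_nonreal_zeros F (4 * s)]].
Proof.
have p0 (x : R) : (2 `^ x)%:C != 0 by rewrite fmorph_eq0 gt_eqF// powR_gt0.
have F0 k := @bessel_nonreal_zeros R nu n k _ 4^-1 (p0 (- nu)).
exists (fun z => (2 `^ (- nu))%:C * bessel_series nu n ((4^-1)%:C * z ^+ 2)).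
(* The constant collects 2^nu from the statement, 2^nu from the series of J_(-nu) and 2^(- nu - n)
   from the power of 2 z; the argument is (2 z)^2 / 4 = z^2. *)
exists (fun z => (2 `^ (nu - n%:R))%:C * bessel_series (- nu) n (1%:C * z ^+ 2)).
split.
- split; first exact: entire_bessel_series.
  move=> z sz; rewrite derive1n_besselJ//.
  have E : cpow z (n%:R - nu) * cpow z (nu - n%:R) = 1.
    by rewrite -cpowD// -(opprB nu) addNr cpow0.
  by rewrite mulrA [cpow z (n%:R - nu) * _]mulrCA E mulr1.
- split; first exact: entire_bessel_series.
  move=> z sz.
  have -> : 2 * z = 2%:C * z by rewrite real_complex_nat.
  have sz2 : slit_plane (2%:C * z) by exact: slit_planeZ.
  rewrite derive1n_besselJ// cpowZ// opprK.
  have -> : (4^-1)%:C * (2%:C * z) ^+ 2 = 1%:C * z ^+ 2.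
    rewrite exprMn mulrA -real_complexX -real_complexM; congr (_%:C * _); by field.
  have E : cpow z (nu + n%:R) * cpow z (- nu - n%:R) = 1.
    by rewrite -cpowD// -(opprD nu) subrr cpow0.
  have -> : nu - n%:R = nu + nu + (- nu - n%:R) by ring.
  have pD (a c : R) : (2 `^ (a + c))%:C = (2 `^ a)%:C * (2 `^ c)%:C.
    by rewrite -real_complexM -powRD// pnatr_eq0 implybT.
  rewrite (pD (nu + nu)) (pD nu nu).
  set x := (2 `^ nu)%:C; set y := (2 `^ (- nu - n%:R))%:C; set b := bessel_series _ _ _.
  transitivity (x * x * y * (cpow z (nu + n%:R) * cpow z (- nu - n%:R)) * b).
    by rewrite E mulr1.
  ring.
have i4 : 0 < 4^-1 :> R by rewrite invr_gt0.
split.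
(* For [k = 0], a single nonreal zero is already a list longer than the bound 0. *)
- move=> nun z Fz; apply/eqP/negPn/negP => Iz.
  have := F0 0%N i4; rewrite subr0 => /(_ nun [:: z]).
  suff H : forall w, w \in [:: z] -> complex.Im w != 0 /\ vanishes_to_order
      (fun z => (2 `^ (- nu))%:C * bessel_series nu n ((4^-1)%:C * z ^+ 2)) w (count_mem w [:: z]).
    by move=> /(_ H).
  move=> w; rewrite inE => /eqP ->; split => //.
  by case=> [|j]; rewrite /= eqxx.
- move=> nu0; rewrite -mulnDr; apply: bessel_nonreal_zeros => //.
  by rewrite natrD; have := truncnS_gt nu; rewrite -natr1; lra.
- move=> s /andP[h _]; rewrite (_ : (4 * s + 2 = 2 * (2 * s + 1))%N); last by lia.
  by apply: F0 => //; rewrite natrD natrM; lra.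
- move=> s _ /andP[h _]; rewrite (_ : (4 * s = 2 * (2 * s))%N); last by lia.
  by apply: F0 => //; rewrite natrM; lra.
Qed.
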